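(* Let $1<p,q<\infty$ with $\frac1p+\frac1q=1$, $n\ge1$ and $0\le k\le n$. Then $E^*L^q(\mathbb{R}^n,\Lambda^k)$ and $EL^p(\mathbb{R}^n,\Lambda^k)$ are orthogonal, meaning that $$\langle\theta,\phi\rangle=\int_{\mathbb{R}^n}\theta\wedge\star\phi=0$$ for any $\theta\in EL^p(\mathbb{R}^n,\Lambda^k)$ and $\phi\in E^*L^q(\mathbb{R}^n,\Lambda^k)$.
   Context: $\Lambda^k=\Lambda^k(\mathbb{R}^{n*})$ is the space of alternating $k$-forms on $\mathbb{R}^n$ (zero if $k<0$ or $k>n$). $L^p(\mathbb{R}^n,\Lambda^k)$ is the space of degree $k$ differential forms with coefficients in $L^p(\mathbb{R}^n)$, and $\mathcal{S}'(\mathbb{R}^n,\Lambda^k)$ is the space of temperate currents of degree $k$, i.e. $k$-forms whose coefficients are tempered distributions. On currents, $d=\sum_{\mu}dx_\mu\wedge\partial_\mu$ and $\delta=-\sum_\mu \iota_\mu\partial_\mu$, where $\iota_\mu$ is the interior product with $\partial/\partial x_\mu$. The space of exact currents in $L^p$ is $EL^p(\mathbb{R}^n,\Lambda^k)=L^p(\mathbb{R}^n,\Lambda^k)\cap d\,\mathcal{S}'(\mathbb{R}^n,\Lambda^{k-1})$, and the space of coexact currents in $L^q$ is $E^*L^q(\mathbb{R}^n,\Lambda^k)=L^q(\mathbb{R}^n,\Lambda^k)\cap\delta\,\mathcal{S}'(\mathbb{R}^n,\Lambda^{k+1})$. $\star$ is the Hodge star: $(dx_{i_1}\wedge\cdots\wedge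 dx_{i_k})\wedge\star(dx_{i_1}\wedge\cdots\wedge dx_{i_k})=dx_1\wedge\cdots\wedge dx_n$ for $i_1<\cdots<i_k$. *)

(* Defs.v *)
From HB Require Import structures.
From mathcomp Require Import all_boot all_order all_algebra.
From mathcomp Require Import all_classical all_reals all_analysis.

Set Implicit Arguments.
Unset Strict Implicit.
Unset Printing Implicit Defensive.

Import Order.TTheory GRing.Theory Num.Theory.
Import numFieldNormedType.Exports.

Local Open Scope classical_set_scope.
Local Open Scope ring_scope.

Definition rV_display : measure_display.
Proof. exact: default_measure_display. Qed.

Section measurable_rV.
Context {R : realType} (n : nat).

(* The product sigma-algebra, i.e. the Borel sets of R^n. *)
Definition rV_coord (i : 'I_n) (x : 'rV[R]_n) : measurableTypeR R := x 0 i.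

Lemma rV_set0 : g_sigma_preimage rV_coord set0.
Proof. exact: sigma_algebra0. Qed.

Lemma rV_setC A : g_sigma_preimage rV_coord A ->
  g_sigma_preimage rV_coord (~` A).
Proof. exact: sigma_algebraC. Qed.

Lemma rV_bigcup (F : (set 'rV[R]_n)^nat) :
  (forall i, g_sigma_preimage rV_coord (F i)) ->
  g_sigma_preimage rV_coord (\bigcup_i F i).
Proof. exact: sigma_algebra_bigcup. Qed.

HB.instance Definition _ := @isMeasurable.Build rV_display
  'rV[R]_n (g_sigma_preimage rV_coord) rV_set0 rV_setC rV_bigcup.

Lemma measurable_rV_coord (i : 'I_n) : measurable_fun setT (rV_coord i).
Proof.
move=> _ Y mY; rewrite setTI; apply: sub_sigma_algebra => /=.
rewrite -bigcup_seq/=; exists i => /=; first by rewrite mem_index_enum.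
by exists Y => //; rewrite setTI.
Qed.

Lemma measurable_fun_rV d (T : measurableType d) (f : T -> 'rV[R]_n) :
  (forall i, measurable_fun setT (rV_coord i \o f)) -> measurable_fun setT f.
Proof.
move=> mf _ A mA; rewrite setTI.
suff : g_sigma_preimage (fun i => rV_coord i \o f) `<=` measurable.
  by rewrite g_sigma_preimage_comp; apply; exists A => //; rewrite setTI.
apply: smallest_sub; first exact: sigma_algebra_measurable.
move=> B; rewrite -bigcup_seq/= => -[i _ [C mC <-]]; exact: mf.
Qed.

End measurable_rV.

Section lebesgue_rV.
Context {R : realType}.
Local Open Scope ereal_scope.

Definition rV_cons n (z : measurableTypeR R * 'rV[R]_n) : 'rV[R]_n.+1 :=
  (\row_i oapp (fun j => z.2 0 j) z.1 (unlift ord0 i))%R.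

Lemma measurable_rV_cons n : measurable_fun setT (@rV_cons n).
Proof.
apply: measurable_fun_rV => i; have [j ->|->] := unliftP ord0 i.
- rewrite (_ : _ \o _ = rV_coord j \o snd).
    by apply: measurableT_comp => //; exact: measurable_rV_coord.
  by apply/funext => z; rewrite /rV_coord /= mxE liftK.
- rewrite (_ : _ \o _ = fst)//.
  by apply/funext => z; rewrite /rV_coord /= mxE unlift_none.
Qed.

Section step.
Variables (n : nat) (m : {sigma_finite_measure set 'rV[R]_n -> \bar R}).

Definition lebesgue_rV_step : set 'rV[R]_n.+1 -> \bar R :=
  pushforward (lebesgue_measure \x m) (@rV_cons n).

Lemma lebesgue_rV_step0 : lebesgue_rV_step set0 = 0.
Proof. by rewrite /lebesgue_rV_step /pushforward preimage_set0 measure0. Qed.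

Lemma lebesgue_rV_step_ge0 A : 0 <= lebesgue_rV_step A.
Proof. by rewrite /lebesgue_rV_step /pushforward measure_ge0. Qed.

Lemma lebesgue_rV_step_sigma_additive : semi_sigma_additive lebesgue_rV_step.
Proof.
move=> F mF tF mUF; rewrite /lebesgue_rV_step /pushforward preimage_bigcup.
have mp A : measurable A -> measurable (@rV_cons n @^-1` A).
  by move=> mA; rewrite -[X in measurable X]setTI; exact: measurable_rV_cons.
apply: measure_semi_sigma_additive.
- by move=> i; exact: mp.
- apply/trivIsetP => /= i j _ _ ij; rewrite -preimage_setI.
  by move/trivIsetP : tF => /(_ _ _ _ _ ij) ->//; rewrite preimage_set0.
- by rewrite -preimage_bigcup; exact: mp.
Qed.

HB.instance Definition _ := isMeasure.Build _ _ _ lebesgue_rV_step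
  lebesgue_rV_step0 lebesgue_rV_step_ge0 lebesgue_rV_step_sigma_additive.

Lemma lebesgue_rV_stepE (A : set (measurableTypeR R)) (B : set 'rV[R]_n) :
  measurable A -> measurable B ->
  lebesgue_rV_step
    [set x : 'rV[R]_n.+1 | A (x 0%R ord0) /\ B (\row_j x 0 (lift ord0 j))%R] =
  lebesgue_measure A * m B.
Proof.
move=> mA mB; rewrite /lebesgue_rV_step /pushforward -product_measure1E//.
congr (product_measure1 _ _ _).
apply/seteqP; split => -[a y] /=; rewrite !mxE unlift_none /=;
  by rewrite (_ : \row_j _ = y)%R//; apply/rowP => j; rewrite !mxE liftK.
Qed.

Lemma measurable_rV_box (A : set (measurableTypeR R)) (B : set 'rV[R]_n) :
  measurable A -> measurable B ->
  measurable [set x : 'rV[R]_n.+1 |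
    A (x 0%R ord0) /\ B (\row_j x 0 (lift ord0 j))%R].
Proof.
move=> mA mB; apply: measurableI.
  rewrite -[X in measurable X]setTI.
  exact: (@measurable_rV_coord R n.+1 ord0).
rewrite -[X in measurable X]setTI.
suff : measurable_fun setT
    (fun x : 'rV[R]_n.+1 => \row_j x 0%R (lift ord0 j) : 'rV[R]_n)%R.
  by apply.
apply: measurable_fun_rV => j.
rewrite (_ : _ \o _ = rV_coord (lift ord0 j)); first exact: measurable_rV_coord.
by apply/funext => x; rewrite /rV_coord /= mxE.
Qed.

Lemma lebesgue_rV_step_sigma_finite : sigma_finite setT lebesgue_rV_step.
Proof.
have /sigma_finiteP[F [TF ndF Foo]] := sigma_finiteT (@lebesgue_measure R).
have /sigma_finiteP[G [TG ndG Goo]] := sigma_finiteT m.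
exists (fun k => [set x : 'rV[R]_n.+1 | F k (x 0%R ord0) /\
                          G k (\row_j x 0 (lift ord0 j))%R]).
  apply/seteqP; split => // x _.
  have [k _ Fk] : (\bigcup_k F k) (x 0%R ord0) by rewrite -TF.
  have [l _ Gl] : (\bigcup_k G k) (\row_j x 0 (lift ord0 j))%R by rewrite -TG.
  exists (maxn k l) => //; split.
    by move: Fk; apply/subsetPset/ndF/leq_maxl.
  by move: Gl; apply/subsetPset/ndG/leq_maxr.
move=> k; have [? ?] := Foo k; have [? ?] := Goo k.
split; first exact: measurable_rV_box.
by rewrite lebesgue_rV_stepE// lte_mul_pinfty// ge0_fin_numE.
Qed.

HB.instance Definition _ := Measure_isSigmaFinite.Build _ _ _
  lebesgue_rV_step lebesgue_rV_step_sigma_finite.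

End step.

(* The point mass in dimension 0, and the image of the product of
   one-dimensional and n-dimensional Lebesgue measure in dimension n + 1. *)
Fixpoint lebesgue_rV n : {sigma_finite_measure set 'rV[R]_n -> \bar R} :=
  match n with
  | 0 => \d_(0%R : 'rV[R]_0)
  | n.+1 => lebesgue_rV_step (lebesgue_rV n)
  end.

Lemma lebesgue_rV_box n (A : 'I_n -> set (measurableTypeR R)) :
  (forall i, measurable (A i)) ->
  lebesgue_rV n [set x | forall i, A i (x 0%R i)] =
  \prod_(i < n) lebesgue_measure (A i).
Proof.
elim: n A => [|n ih] A mA.
  by rewrite big_ord0 /= diracE mem_set// => -[].
rewrite big_ord_recl -ih//.
pose B := [set y : 'rV[R]_n | forall i, A (lift ord0 i) (y 0%R i)].
have mB : measurable B.
  rewrite (_ : B = \bigcap_(i in [set: 'I_n])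
      (rV_coord i @^-1` A (lift ord0 i))).
    apply: fin_bigcap_measurable => // i _.
    by rewrite -[X in measurable X]setTI; apply: measurable_rV_coord.
  by apply/seteqP; split => y /= yA i; [move=> _|]; exact: yA.
rewrite -[RHS]lebesgue_rV_stepE//=; congr (lebesgue_rV_step _ _).
apply/seteqP; split => x /=.
  by move=> Ax; split => // i; rewrite mxE.
move=> [A0 AS] i; have [j ->|->//] := unliftP ord0 i.
by have := AS j; rewrite mxE.
Qed.

End lebesgue_rV.

Section schwartz.
Context {R : realType} {n : nat}.
Implicit Types (f g : 'rV[R]_n -> R) (a : {ffun 'I_n -> nat}) (s : seq 'I_n).

Definition partial (i : 'I_n) f : 'rV[R]_n -> R := 'D_('e_i) f.

Definition iter_partial s f : 'rV[R]_n -> R := foldr partial f s.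

Definition monomial a (x : 'rV[R]_n) : R := \prod_i x 0 i ^+ a i.

Definition is_schwartz f : Prop :=
  (forall s x, differentiable (iter_partial s f) x) /\
  (forall a s, exists M : R, forall x, `|monomial a x * iter_partial s f x| <= M).

Lemma iter_partial0 s : iter_partial s (0 : _ -> R) = 0.
Proof.
elim: s => //= i s ->; apply/funext => x.
by rewrite /partial (_ : 0 = cst 0)// derive_cst.
Qed.

Lemma iter_partialP (c : R) f g s :
  (forall s x, differentiable (iter_partial s f) x) ->
  (forall s x, differentiable (iter_partial s g) x) ->
  iter_partial s (c *: f + g) = c *: iter_partial s f + iter_partial s g.
Proof.
move=> df dg; elim: s => //= i s ->; apply/funext => x; rewrite /partial.
rewrite deriveD; last 2 first.
- by apply: derivableZ; exact/diff_derivable.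
- exact/diff_derivable.
by rewrite deriveZ//; exact/diff_derivable.
Qed.

Definition schwartz_pred : {pred ('rV[R]_n -> R)} := mem [set f | is_schwartz f].

Lemma is_schwartz_submod : submod_closed schwartz_pred.
Proof.
split=> [|c f g]; rewrite !inE /= /is_schwartz.
- split=> [s x|a s]; first by rewrite iter_partial0; exact: differentiable_cst.
  by exists 0 => x; rewrite iter_partial0 mulr0 normr0.
- move=> [df bf] [dg bg]; split=> [s x|a s].
    rewrite iter_partialP//; apply: differentiableD => //.
    exact: differentiableZ.
  have [M fM] := bf a s; have [N gN] := bg a s.
  exists (`|c| * M + N) => x; rewrite iter_partialP//.
  rewrite [X in _ * X](_ : _ = c * iter_partial s f x + iter_partial s g x)//.
  rewrite mulrDr (le_trans (ler_normD _ _))// lerD//.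
  by rewrite mulrCA normrM ler_wpM2l.
Qed.

HB.instance Definition _ := GRing.isSubmodClosed.Build _ _
  schwartz_pred is_schwartz_submod.

Record schwartz : Type := Schwartz {
  schwartz_fun :> 'rV[R]_n -> R ;
  schwartz_mem : schwartz_fun \in schwartz_pred }.

HB.instance Definition _ := [isSub for schwartz_fun].
HB.instance Definition _ := [Choice of schwartz by <:].
HB.instance Definition _ := [SubChoice_isSubLmodule of schwartz by <:].

(* The Schwartz topology is the initial topology for all the maps
   f |-> x^a * partial_s f into the bounded functions with uniform
   convergence, i.e. the one given by the usual seminorms. *)
Definition schwartz_jet (f : schwartz) :
    {ptws {ffun 'I_n -> nat} * seq 'I_n -> {uniform 'rV[R]_n -> R}} :=
  fun b x => monomial b.1 x * iter_partial b.2 f x.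

HB.instance Definition _ :=
  Topological.copy schwartz (initial_topology schwartz_jet).

Lemma partial_schwartz_mem i (f : schwartz) : partial i f \in schwartz_pred.
Proof.
have iter_rcons s : iter_partial s (partial i f) = iter_partial (rcons s i) f.
  by rewrite /iter_partial foldr_rcons.
have := schwartz_mem f; rewrite !inE => -[df bf].
by split=> [s x|a s]; rewrite iter_rcons.
Qed.

Definition schwartz_partial i (f : schwartz) : schwartz :=
  Schwartz (partial_schwartz_mem i f).

Definition tempered_distribution (T : schwartz -> R) : Prop :=
  scalar T /\ continuous T.

Definition distribution_partial i (T : schwartz -> R) : schwartz -> R :=
  fun phi => - T (schwartz_partial i phi).

Definition distribution_of (g : 'rV[R]_n -> R) : schwartz -> R :=
  fun phi => \int[lebesgue_rV n]_x (g x * phi x).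

End schwartz.
Arguments schwartz : clear implicits.

(* A form u with coefficients in V stands for \sum_I u I dx_I, where
   dx_I = dx_(i_1) /\ ... /\ dx_(i_k) if I = {i_1 < ... < i_k}. *)
Definition ext_form (n : nat) (V : Type) : Type := {set 'I_n} -> V.

Section exterior.
Context {n : nat}.
Implicit Types (I J K : {set 'I_n}) (i : 'I_n).

Definition homogeneous (V : zmodType) (k : int) (u : ext_form n V) : Prop :=
  forall I, #|I|%:Z != k -> u I = 0.

(* For disjoint I and J, dx_I /\ dx_J = (-1) ^+ inversions I J dx_(I :|: J). *)
Definition inversions I J : nat :=
  #|[pred ij : 'I_n * 'I_n | [&& ij.1 \in I, ij.2 \in J & (ij.2 < ij.1)%N]]|.

Context {R : comNzRingType}.

Definition dx I : ext_form n R := fun J => (J == I)%:R.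

Definition wedge (V : lmodType R) (u : ext_form n R) (v : ext_form n V) : ext_form n V :=
  fun K => \sum_(I : {set 'I_n} | I \subset K)
    (-1) ^+ inversions I (K :\: I) *: (u I *: v (K :\: I)).

(* Interior product with the i-th coordinate vector field; compare
   iota_wedge_dx and iota_dx. *)
Definition iota_form (V : lmodType R) i (u : ext_form n V) : ext_form n V :=
  fun K => if i \in K then 0
           else (-1) ^+ inversions [set i]%SET K *: u (i |: K)%SET.

(* The linear map with dx_I |-> (-1) ^+ inversions I (~: I) dx_(~: I). *)
Definition hodge (u : ext_form n R) : ext_form n R :=
  fun J => (-1) ^+ inversions (~: J) J * u (~: J).

Lemma wedge_dxl (V : lmodType R) I (v : ext_form n V) K :
  wedge (dx I) v K =
  if I \subset K then (-1) ^+ inversions I (K :\: I) *: v (K :\: I) else 0.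
Proof.
rewrite /wedge /dx; case: ifPn => IK.
  rewrite (bigD1 I)//= eqxx scale1r big1 ?addr0// => L /andP[_ /negbTE ->].
  by rewrite scale0r scaler0.
rewrite big1// => L LK; have [LI|] := eqVneq L I; last first.
  by rewrite scale0r scaler0.
by rewrite -LI LK in IK.
Qed.

Lemma wedge_dx I J K : I :&: J = finset.set0 ->
  wedge (V := R^o) (dx I) (dx J) K = (-1) ^+ inversions I J * dx (I :|: J) K.
Proof.
move=> dIJ; rewrite wedge_dxl /dx; case: ifPn => IK.
  have JI : (J :\: I)%SET = J.
    by apply/finset.setDidPl; rewrite -finset.setI_eq0 finset.setIC dIJ.
  have [->|KIJ] := eqVneq K (I :|: J)%SET.
    by rewrite finset.setDUl finset.setDv finset.set0U JI eqxx.
  rewrite (_ : _ == J = false) ?scaler0 ?mulr0//; apply/negbTE.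
  apply: contraNneq KIJ => <-.
  by rewrite -{1}(finset.setID K I) (finset.setIidPr IK).
rewrite (_ : K == _ = false) ?mulr0//; apply/negbTE.
by apply: contraNneq IK => ->; exact: finset.subsetUl.
Qed.

Lemma hodge_dx I J :
  hodge (dx I) J = (-1) ^+ inversions I (~: I) * dx (~: I) J.
Proof.
rewrite /hodge /dx; have [->|JI] := eqVneq J (~: I)%SET.
  by rewrite finset.setCK eqxx.
rewrite (_ : _ == I = false) ?mulr0//; apply: contraNF JI => /eqP <-.
by rewrite finset.setCK.
Qed.

Lemma wedge_hodge_dx I K :
  wedge (V := R^o) (dx I) (hodge (dx I)) K = dx [set: 'I_n]%SET K.
Proof.
rewrite wedge_dxl hodge_dx /dx; case: ifPn => IK; last first.
  rewrite (_ : K == _ = false)//; apply: contraNF IK => /eqP ->.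
  exact: finset.subsetT.
have [->|KT] := eqVneq K finset.setT.
  by rewrite finset.setTD eqxx mulr1 -[LHS]/(_ * _) -expr2 sqrr_sign.
rewrite (_ : _ == _ = false) ?mulr0 ?scaler0//.
apply: contraNF KT => /eqP KI.
by rewrite -(finset.setID K I) (finset.setIidPr IK) KI finset.setUCr.
Qed.

Lemma iota_wedge_dx (V : lmodType R) i (v : ext_form n V) K : i \notin K ->
  iota_form i (wedge (dx [set i]%SET) v) K = v K.
Proof.
move=> iK; rewrite /iota_form (negbTE iK) wedge_dxl finset.sub1set finset.setU11.
by rewrite finset.setU1K// scalerA -expr2 sqrr_sign scale1r.
Qed.

Lemma iota_dx i I K : i \notin I -> iota_form (V := R^o) i (dx I) K = 0.
Proof.
move=> iI; rewrite /iota_form /dx; case: ifPn => // iK.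
rewrite (_ : _ == I = false) ?scaler0//; apply: contraNF iI => /eqP <-.
exact: finset.setU11.
Qed.

End exterior.

Section currents.
Context {R : realType} {n : nat}.
Implicit Types (k : int) (T : ext_form n (schwartz R n -> R)).

Definition temperate_current k T : Prop :=
  homogeneous k T /\ forall I, tempered_distribution (T I).

Definition current_partial i T : ext_form n (schwartz R n -> R) :=
  fun I => distribution_partial i (T I).

Definition current_d T : ext_form n (schwartz R n -> R) :=
  \sum_(i < n) wedge (dx [set i]%SET) (current_partial i T).

Definition current_delta T : ext_form n (schwartz R n -> R) :=
  - \sum_(i < n) iota_form i (current_partial i T).

Definition Lp_form (p : R) k (u : ext_form n ('rV[R]_n -> R)) : Prop :=
  homogeneous k u /\ forall I, u I \in Lfun (lebesgue_rV n) p%:E.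

Definition current_of (u : ext_form n ('rV[R]_n -> R)) :
    ext_form n (schwartz R n -> R) :=
  fun I => distribution_of (u I).

(* Equality in current_of u = current_d T is equality of tempered
   distributions, coefficient by coefficient; since the degree k - 1 is an
   int, T = 0 when k = 0. *)
Definition EL (p : R) k : set (ext_form n ('rV[R]_n -> R)) :=
  [set u | Lp_form p k u /\
    exists2 T, temperate_current (k - 1) T & current_of u = current_d T].

Definition EstarL (q : R) k : set (ext_form n ('rV[R]_n -> R)) :=
  [set u | Lp_form q k u /\
    exists2 T, temperate_current (k + 1) T & current_of u = current_delta T].

Definition ext_form_at (u : ext_form n ('rV[R]_n -> R)) (x : 'rV[R]_n) : ext_form n R :=
  fun I => u I x.

(* The integral of an n-form is that of its coefficient of
   dx_1 /\ ... /\ dx_n. *)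
Definition pairing (u v : ext_form n ('rV[R]_n -> R)) : \bar R :=
  \int[lebesgue_rV n]_x
    (wedge (ext_form_at u x) (hodge (ext_form_at v x)) [set: 'I_n]%SET)%:E.

End currents.

(* Main.v *)
Require Import Defs.
From mathcomp Require Import all_boot all_order all_algebra.
From mathcomp Require Import all_classical all_reals all_analysis.
From mathcomp Require Import measurable_realfun ring lra.

(** The theorem holds because translating an exact form does not change its
pairing with a coexact form, while translating it to infinity makes the
pairing vanish.

Write [theta = dS] and [phi = delta T].  Then [d theta = 0] and
[delta phi = 0] as currents ([current_dd], [current_deltadelta]).  Consider
the correlation
  [f(y) = sum_I int phi_I(x) theta_I(x + y) dx],
a bounded function by Hoelder's inequality, with [f(0) = <theta, phi>].
Formally [f(y)] is the pairing of the translate of [theta] by [y] with [phi].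
By Cartan's formula the Lie derivative of the closed form [theta] along a
constant vector field is [d(iota theta)], and moving [d] to the other side
turns it into [delta phi = 0]; so every partial derivative of [f] vanishes
in the sense of distributions.  In coordinates this is the purely algebraic
identity [cartan_sum], and Fubini's theorem turns it into
[corr_gauss_partial_eq0]: [f] is orthogonal to the partial derivatives of all
Gaussians.

Consequently [t |-> int f(y) exp(-c |y - t e_j|^2) dy] is constant.  Since
[f] tends to [0] along [e_j] ([corr_cvg0]: both exponents are finite, so the
two factors live, up to small errors, on sets which a large translation
separates), the constant is [0] and [f] is orthogonal to every centred
Gaussian ([integral_gaussian_eq0]).  These concentrate at the origin, where
[f] is continuous ([cvg_corr], a density argument in [L^p]), so
[f(0) = 0].

Gaussians are the only test functions which occur: their partial derivatives
are Hermite-like products of functions of one variable, so that membership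
in the Schwartz space ([polygauss_schwartz]) and the symmetry of second
derivatives ([gauss_commute]) can be read off. *)

Set Implicit Arguments.
Unset Strict Implicit.
Unset Printing Implicit Defensive.

Import Order.TTheory GRing.Theory Num.Theory.
Import numFieldNormedType.Exports.

Local Open Scope classical_set_scope.
Local Open Scope ring_scope.

(** * Lebesgue measure under affine maps and on products *)

Section affine1.
Context {R : realType}.
Local Open Scope ereal_scope.

Definition affine1 (s a : R) (t : R) : R := (s * t + a)%R.

Lemma measurable_affine1 s a : measurable_fun setT (affine1 s a).
Proof.
by apply: measurable_funD => //; apply: measurable_funM.
Qed.

(** The image of Lebesgue measure under [t |-> s t + a], multiplied by [s],
agrees with Lebesgue measure on half-open intervals. *)
Lemma ge0_integral_affine1 (s a : R) (g : R -> \bar R) :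
  (0 < s)%R -> measurable_fun setT g -> (forall t, 0 <= g t) ->
  \int[lebesgue_measure]_t g t = s%:E * \int[lebesgue_measure]_t g (s * t + a)%R.
Proof.
move=> s0 mg g0.
have maff := measurable_affine1 s a.
pose mm := mscale (NngNum (ltW s0))
  (pushforward lebesgue_measure (affine1 s a : measurableTypeR R ->
    measurableTypeR R)).
pose m2 : {measure set (measurableTypeR R) -> \bar R} := mm maff.
rewrite (eq_measure_integral m2); last first.
  move=> A mA _; apply: (lebesgue_measure_unique
    (mu := m2)) => //= X /ocitvP[->|].
    by rewrite !measure0.
  move=> [[b c] /= bc ->]; rewrite /m2 /mm /= /mscale /= /pushforward.
  have -> : affine1 s a @^-1` `]b, c] =
     `](b - a) / s, (c - a) / s]%classic%R.
    apply/seteqP; split => x /=; rewrite /affine1 !in_itv /=;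
      by rewrite ltr_pdivrMr// ler_pdivlMr// ltrBlDr lerBrDr mulrC.
  rewrite !lebesgue_measure_itv/= !lte_fin ltr_pM2r ?invr_gt0// ltrD2r bc.
  rewrite -!EFinD -EFinM; congr EFin.
  by field; rewrite gt_eqF.
rewrite ge0_integral_mscale//.
by rewrite ge0_integral_pushforward//.
Qed.
End affine1.

Section lebesgue_rV_integral.
Context {R : realType}.
Local Open Scope ereal_scope.

(** Tonelli's theorem for the first coordinate; it drives the inductions on
the dimension below. *)
Lemma ge0_integral_rVS n (g : 'rV[R]_n.+1 -> \bar R) :
  measurable_fun setT g -> (forall x, 0 <= g x) ->
  \int[lebesgue_rV n.+1]_x g x =
  \int[lebesgue_measure]_t \int[lebesgue_rV n]_y g (rV_cons (t, y)).
Proof.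
move=> mg g0.
transitivity (\int[pushforward (lebesgue_measure \x lebesgue_rV n)
  (@rV_cons R n)]_x g x).
  by [].
rewrite ge0_integral_pushforward//; last exact: measurable_rV_cons.
rewrite preimage_setT fubini_tonelli1//; last by move=> z; exact: g0.
by apply: measurableT_comp => //; exact: measurable_rV_cons.
Qed.

Lemma measurable_rV_affine n (s : R) (a : 'rV[R]_n) :
  measurable_fun setT (fun x : 'rV[R]_n => s *: x + a)%R.
Proof.
apply: measurable_fun_rV => i.
rewrite (_ : _ \o _ = fun x => s * rV_coord i x + a 0 i)%R; last first.
  by apply/funext => x; rewrite /rV_coord /= !mxE.
apply: measurable_funD => //; apply: measurable_funM => //.
exact: measurable_rV_coord.
Qed.

Lemma ge0_integral_rV_affine n (s : R) (a : 'rV[R]_n) (g : 'rV[R]_n -> \bar R) :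
  (0 < s)%R -> measurable_fun setT g -> (forall x, 0 <= g x) ->
  \int[lebesgue_rV n]_x g x = (s ^+ n)%:E * \int[lebesgue_rV n]_x g
    (s *: x + a)%R.
Proof.
move=> s0; elim: n a g => [|n ih] a g mg g0.
  rewrite expr0 mul1e; apply: eq_integral => x _; congr g.
  by apply/rowP => -[].
have mga : measurable_fun setT (fun x : 'rV[R]_n.+1 => g (s *: x + a)%R).
  by apply: (measurableT_comp mg); exact: measurable_rV_affine.
rewrite !ge0_integral_rVS//.
pose h t := \int[lebesgue_rV n]_y g (rV_cons (t, y)).
have mgc : measurable_fun setT (g \o @rV_cons R n).
  by apply: measurableT_comp => //; exact: measurable_rV_cons.
have mh : measurable_fun setT h.
  by apply: (measurable_fun_fubini_tonelli_F (m2 := lebesgue_rV n) _ mgc) => z;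
    exact: g0.
have h0 t : 0 <= h t by exact: integral_ge0.
rewrite (ge0_integral_affine1 (a 0%R ord0) s0 mh h0).
under eq_integral => t _.
  rewrite /h (ih (\row_j a 0 (lift ord0 j))%R); last 2 first.
  - by apply: (measurableT_comp mgc); exact: pair1_measurable.
  - by [].
  over.
have consE t y : rV_cons ((s * t + a 0 ord0)%R, (s *: y + \row_j a 0
  (lift ord0 j))%R) =
    (s *: rV_cons (t, y) + a)%R.
  apply/rowP => i; rewrite !mxE /=.
  by have [j ->|->] := unliftP ord0 i; rewrite ?liftK ?unlift_none /= ?mxE.
have hE t : \int[lebesgue_rV n]_y
    (g \o rV_cons (n:=n)) ((s * t + a 0 ord0)%R, (s *: y + \row_j a 0
      (lift ord0 j))%R)
  = \int[lebesgue_rV n]_y g (s *: rV_cons (t, y) + a)%R.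
  by apply: eq_integral => y _; rewrite /= consE.
under eq_integral do rewrite hE.
rewrite ge0_integralZl//.
- by rewrite muleA -EFinM exprS.
- pose k z := g (s *: rV_cons z + a)%R.
  apply: (measurable_fun_fubini_tonelli_F (m2 := lebesgue_rV n) k);
    last by move=> z; exact: g0.
  by apply: (measurableT_comp mga); exact: measurable_rV_cons.
- by move=> t _; exact: integral_ge0.
- by rewrite lee_fin exprn_ge0// ltW.
Qed.

Lemma measurable_prod_coord n (h : 'I_n -> R -> R) :
  (forall i, measurable_fun setT (h i)) ->
  measurable_fun setT (fun x : 'rV[R]_n => \prod_i h i (x 0%R i))%R.
Proof.
move=> mh; apply: measurable_prod => i _.
by apply: (measurableT_comp (mh i)); exact: measurable_rV_coord.
Qed.

Lemma ge0_integral_prod_coord n (h : 'I_n -> R -> R) :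
  (forall i, measurable_fun setT (h i)) -> (forall i t, 0 <= h i t)%R ->
  \int[lebesgue_rV n]_x (\prod_i h i (x 0%R i))%:E =
  \prod_i \int[lebesgue_measure]_t (h i t)%:E.
Proof.
elim: n h => [|n ih] h mh h0.
  rewrite big_ord0 /= integral_dirac//= ?diracT ?mul1e.
    by rewrite big_ord0.
  by apply/measurable_EFinP; exact: measurable_prod_coord.
rewrite ge0_integral_rVS; last 2 first.
- by apply/measurable_EFinP; exact: measurable_prod_coord.
- by move=> x; rewrite lee_fin prodr_ge0// => i _; exact: h0.
rewrite big_ord_recl -ih//.
rewrite -ge0_integralZr//; last 3 first.
- by apply/measurable_EFinP; exact: mh.
- by move=> t _; rewrite lee_fin.
- by apply: integral_ge0 => x _; rewrite lee_fin prodr_ge0// => i _; exact: h0.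
apply: eq_integral => t _.
rewrite -ge0_integralZl//; last 3 first.
- apply/measurable_EFinP;
    apply: (@measurable_prod_coord n (fun i => h (lift ord0 i))) => i;
  exact: mh.
- by move=> x _; rewrite lee_fin prodr_ge0// => i _; exact: h0.
- by rewrite lee_fin.
apply: eq_integral => y _; rewrite -EFinM; congr EFin.
rewrite big_ord_recl mxE unlift_none /=; congr (_ * _)%R.
by apply: eq_bigr => i _; rewrite mxE liftK.
Qed.

End lebesgue_rV_integral.

(** * Gaussians *)

Section gaussian.
Context {R : realType} {n : nat}.
Implicit Types (x y : 'rV[R]_n) (c : R).

Definition sqnorm x : R := \sum_i x 0 i ^+ 2.

Definition gaussian c x : R := expR (- c * sqnorm x).

Lemma sqnorm_ge0 x : 0 <= sqnorm x.
Proof. by apply: sumr_ge0 => i _; rewrite sqr_ge0. Qed.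

Lemma gaussianE c x : gaussian c x = \prod_i expR (- c * x 0 i ^+ 2).
Proof. by rewrite /gaussian mulr_sumr expR_sum. Qed.

Lemma gaussian_ge0 c x : 0 <= gaussian c x.
Proof. exact: expR_ge0. Qed.

Lemma measurable_gaussian c : measurable_fun setT (gaussian c).
Proof.
rewrite (funext (gaussianE c)).
apply: (measurable_prod_coord (h := fun _ t => expR (- c * t ^+ 2))) => i.
by apply: measurableT_comp => //; exact: measurable_funM.
Qed.

Lemma sqnormZ c x : sqnorm (c *: x) = c ^+ 2 * sqnorm x.
Proof. by rewrite mulr_sumr; apply: eq_bigr => i _; rewrite mxE exprMn. Qed.

Lemma gaussian_scale c x : 0 < c -> gaussian (c ^- 2) (c *: x) = gaussian 1 x.
Proof.
move=> c0; rewrite /gaussian sqnormZ mulrA; congr (expR (_ * _)).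
by rewrite mulNr mulVf// gt_eqF// exprn_gt0.
Qed.

Lemma sqnormN x : sqnorm (- x) = sqnorm x.
Proof. by apply: eq_bigr => i _; rewrite mxE sqrrN. Qed.

Lemma gaussianN c x : gaussian c (- x) = gaussian c x.
Proof. by rewrite /gaussian sqnormN. Qed.

Lemma powR_gaussian c r x : gaussian c x `^ r = gaussian (c * r) x.
Proof. by rewrite /gaussian -expRM; congr expR; ring. Qed.

(** Uniform domination of the translates of a Gaussian by a wider one: it
follows from [|x + y|^2 >= |x|^2 / 2 - |y|^2]. *)
Lemma gaussianD c x y : 0 < c ->
  gaussian c (x + y) <= expR (c * sqnorm y) * gaussian (c / 2) x.
Proof.
move=> c0; rewrite /gaussian -expRD ler_expR -subr_ge0.
have -> : c * sqnorm y + - (c / 2) * sqnorm x - - c * sqnorm (x + y) =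
    c / 2 * \sum_i (x 0 i + 2 * y 0 i) ^+ 2.
  rewrite /sqnorm !mulr_sumr -sumrN -!big_split /=.
  by apply: eq_bigr => i _; rewrite mxE; field.
rewrite mulr_ge0 ?divr_ge0 ?(ltW c0)//.
by apply: sumr_ge0 => i _; rewrite sqr_ge0.
Qed.

(** Half of the exponent absorbs the linear factor, because
[1 + |x|^2 <= (1 + 2 / c) (1 + c |x|^2 / 2) <= (1 + 2 / c) exp(c |x|^2 / 2)]. *)
Lemma norm_coord_gaussian c i x : 0 < c ->
  `|x 0 i| * gaussian c x <= (1 + 2 / c) * gaussian (c / 2) x.
Proof.
move=> c0.
have -> : gaussian c x = gaussian (c / 2) x * gaussian (c / 2) x.
  by rewrite /gaussian -expRD; congr expR; field.
rewrite mulrA ler_wpM2r ?gaussian_ge0//.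
have xi : `|x 0 i| <= 1 + sqnorm x.
  have : x 0 i ^+ 2 <= sqnorm x.
    by rewrite /sqnorm (bigD1 i)//= lerDl sumr_ge0// => j _; rewrite sqr_ge0.
  rewrite -real_normK ?num_real//.
  have := normr_ge0 (x 0 i); nra.
rewrite /gaussian mulNr expRN ler_pdivrMr ?expR_gt0//.
apply: (le_trans xi); apply: (@le_trans _ _ ((1 + 2 / c) *
  (1 + c / 2 * sqnorm x))).
  have -> : (1 + 2 / c) * (1 + c / 2 * sqnorm x) = 1 + sqnorm x +
    (2 / c + c / 2 * sqnorm x).
    by field; rewrite gt_eqF.
  by rewrite lerDl addr_ge0// ?divr_ge0 ?mulr_ge0 ?sqnorm_ge0 ?ltW// divr_gt0.
rewrite ler_wpM2l ?expR_ge1Dx//.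
by rewrite addr_ge0// divr_ge0// ltW.
Qed.

Local Open Scope ereal_scope.

(** The integral is [sqrt (pi / c) ^ n]; its positivity allows one to divide by
it in [sum_corr_eq0]. *)
Lemma integral_gaussian c : (0 < c)%R ->
  exists2 r : R, (0 < r)%R & \int[lebesgue_rV n]_x (gaussian c x)%:E = r%:E.
Proof.
move=> c0.
have mh : measurable_fun setT (fun t : R => expR (- c * t ^+ 2)).
  by apply: measurableT_comp => //; exact: measurable_funM.
under eq_integral do rewrite gaussianE.
rewrite (ge0_integral_prod_coord (h := fun _ t => expR (- c * t ^+ 2)))//.
have s0 : (0 < (Num.sqrt c)^-1)%R by rewrite invr_gt0 sqrtr_gt0.
rewrite (@ge0_integral_affine1 _ _ 0 _ s0); last 2 first.
- exact/measurable_EFinP.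
- by move=> t; rewrite lee_fin expR_ge0.
have -> : \int[lebesgue_measure]_t
    (expR (- c * ((Num.sqrt c)^-1 * t + 0) ^+ 2))%:E = (Num.sqrt pi)%:E.
  rewrite -integralT_gauss; apply: eq_integral => t _; congr (expR _)%:E.
  rewrite addr0 exprMn exprVn sqr_sqrtr ?ltW// mulrA mulNr mulfV ?mulN1r//.
  by rewrite gt_eqF.
exists (\prod_(i < n) ((Num.sqrt c)^-1 * Num.sqrt pi))%R;
  last by rewrite -prodEFin.
by rewrite prodr_gt0// => i _; rewrite mulr_gt0// sqrtr_gt0 pi_gt0.
Qed.

Lemma Lfun_gaussian_dom (p K c : R) (g : 'rV[R]_n -> R) : (0 < p)%R ->
  (0 < c)%R ->
  measurable_fun setT g -> (forall x, `|g x| <= K * gaussian c x)%R ->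
  g \in Lfun (lebesgue_rV n) p%:E.
Proof.
move=> p0 c0 mg gK.
rewrite inE; apply/andP; split; rewrite inE//=.
rewrite /finite_norm unlock.
apply: poweR_lty.
have cp : (0 < c * p)%R by rewrite mulr_gt0.
have [r r0 rE] := integral_gaussian cp.
apply: (@le_lt_trans _ _ (\int[lebesgue_rV n]_x ((`|K| `^ p)%:E * (gaussian
  (c * p) x)%:E))); last first.
  rewrite ge0_integralZl//.
  - by rewrite rE -EFinM ltry.
  - by apply/measurable_EFinP; exact: measurable_gaussian.
  - by move=> x _; rewrite lee_fin gaussian_ge0.
apply: ge0_le_integral => //=.
- apply/measurable_EFinP; apply: (measurableT_comp (measurable_powR _)).
  exact: measurableT_comp.
- apply/measurable_EFinP; apply: measurable_funM => //;
    exact: measurable_gaussian.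
move=> x _; rewrite -EFinM lee_fin -powR_gaussian -powRM ?gaussian_ge0//.
apply: ge0_ler_powR; rewrite ?nnegrE ?mulr_ge0 ?gaussian_ge0//.
  exact: ltW.
by rewrite (le_trans (gK x))// ler_wpM2r ?gaussian_ge0// ler_norm.
Qed.

End gaussian.

(** * Hoelder's inequality and dominated convergence in L^p *)

Section Lfun_facts.
Context d (T : measurableType d) (R : realType) (mu : {measure set T -> \bar R}).
Local Open Scope ereal_scope.
Implicit Types (p q : R) (f g u v : T -> R).

Definition Lnormr p f : R := fine 'N[mu]_p%:E[EFin \o f].

Lemma Lfun_measurable p f : f \in Lfun mu p%:E -> measurable_fun setT f.
Proof. by rewrite inE => /andP[/[!inE]]. Qed.

Lemma LnormrE p f : f \in Lfun mu p%:E -> 'N[mu]_p%:E[EFin \o f] =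
  (Lnormr p f)%:E.
Proof.
rewrite inE => /andP[_ /[!inE]/= fp].
by rewrite /Lnormr fineK// ge0_fin_numE ?Lnorm_ge0.
Qed.

Lemma Lnormr_ge0 p f : (0 <= Lnormr p f)%R.
Proof. by rewrite fine_ge0// Lnorm_ge0. Qed.

Lemma hoelder_le p q u v : (0 < p)%R -> (0 < q)%R -> (p^-1 + q^-1 = 1)%R ->
  u \in Lfun mu q%:E -> v \in Lfun mu p%:E ->
  \int[mu]_x `|(u x * v x)%:E| <= (Lnormr q u * Lnormr p v)%:E.
Proof.
move=> p0 q0 pq uq vp.
rewrite addrC in pq.
have := hoelder mu (Lfun_measurable uq) (Lfun_measurable vp) q0 p0 pq.
by rewrite Lnorm1 (LnormrE uq) (LnormrE vp) -EFinM; exact.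
Qed.

Lemma hoelder_integrable p q u v : (0 < p)%R -> (0 < q)%R ->
  (p^-1 + q^-1 = 1)%R ->
  u \in Lfun mu q%:E -> v \in Lfun mu p%:E ->
  mu.-integrable setT (fun x => (u x * v x)%:E).
Proof.
move=> p0 q0 pq uq vp; apply/integrableP; split.
  apply/measurable_EFinP; apply: measurable_funM.
    exact: (Lfun_measurable uq).
  exact: (Lfun_measurable vp).
exact: (le_lt_trans (hoelder_le p0 q0 pq uq vp) (ltry _)).
Qed.

Lemma Rintegral_hoelder p q u v : (0 < p)%R -> (0 < q)%R -> (p^-1 + q^-1 = 1)%R ->
  u \in Lfun mu q%:E -> v \in Lfun mu p%:E ->
  (`| \int[mu]_x (u x * v x) | <= Lnormr q u * Lnormr p v)%R.
Proof.
move=> p0 q0 pq uq vp.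
have iuv := hoelder_integrable p0 q0 pq uq vp.
rewrite -lee_fin EFin_normr_Rintegral//.
apply: le_trans (hoelder_le p0 q0 pq uq vp).
by apply: le_abse_integral => //; case/integrableP: iuv.
Qed.

(** Dominated convergence for [|h k| `^ p], followed by continuity of the
[p]-th root at [0]. *)
Lemma Lnormr_dct p (h : nat -> T -> R) (V : T -> R) : (0 < p)%R ->
  (forall k, measurable_fun setT (h k)) -> V \in Lfun mu p%:E ->
  (forall k x, `|h k x| <= `|V x|)%R -> (forall x, h ^~ x @ \oo --> 0%R) ->
  Lnormr p (h k) @[k --> \oo] --> 0%R.
Proof.
move=> p0 mh VL hV h0.
have mV := Lfun_measurable VL.
have mP f : measurable_fun setT f -> measurable_fun setT (fun x =>
  (`|f x| `^ p)%:E).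
  move=> mf; apply/measurable_EFinP;
    apply: (measurableT_comp (measurable_powR _)).
  exact: measurableT_comp.
have nV : \int[mu]_x (`|V x| `^ p)%:E < +oo.
  have := LnormrE VL; rewrite unlock /= => E.
  apply: (@lty_poweRy _ _ p^-1); first by rewrite gt_eqF// invr_gt0.
  by rewrite E ltry.
have iV : mu.-integrable setT (fun x => (`|V x| `^ p)%:E).
  apply/integrableP; split; first exact: mP.
  by under eq_integral do rewrite gee0_abs ?lee_fin ?powR_ge0//.
have le_hV k x : (`|h k x| `^ p <= `|V x| `^ p)%R.
  by apply: ge0_ler_powR; rewrite ?nnegrE// ltW.
have hp0 x : (`|h k x| `^ p)%R @[k --> \oo] --> (0 : R)%R.
  apply/cvgrPdist_le => e e0.
  have e1 : (0 < e `^ p^-1)%R by rewrite powR_gt0.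
  near=> k; rewrite sub0r normrN ger0_norm ?powR_ge0//.
  have : (`|h k x| <= e `^ p^-1)%R.
    by near: k; have /cvgrPdist_le/(_ _ e1) := h0 x; apply: filterS => k;
      rewrite sub0r normrN.
  move/(ge0_ler_powR (ltW p0)) => /(_ _ _)/le_trans; apply;
    rewrite ?nnegrE ?powR_ge0//.
  by rewrite -powRrM mulVf ?gt_eqF// powRr1// ltW.
have : \int[mu]_x (`|h k x| `^ p)%:E @[k --> \oo] --> 0.
  rewrite -(integral0 mu setT).
  apply: (@dominated_cvg _ _ _ mu _ measurableT _ _ (fun x =>
    (`|V x| `^ p)%:E)) => //.
  - by move=> k; exact: mP.
  - move=> x _; apply: cvg_EFin; first exact: nearW.
    exact: hp0.
  - by move=> k x _; rewrite gee0_abs ?lee_fin ?powR_ge0.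
move=> /fine_cvgP[_ ih].
apply/cvgrPdist_le => e e0.
have e1 : (0 < e `^ p)%R by rewrite powR_gt0.
near=> k; rewrite sub0r normrN ger0_norm ?Lnormr_ge0//.
rewrite /Lnormr unlock /=.
have ik : \int[mu]_x (`|h k x| `^ p)%:E \is a fin_num.
  rewrite ge0_fin_numE; last by apply: integral_ge0 => x _;
    rewrite lee_fin powR_ge0.
  apply: le_lt_trans nV; apply: ge0_le_integral => //.
  - exact: mP.
  - exact: mP.
  - by move=> x _; rewrite lee_fin.
rewrite -(fineK ik) poweR_EFin /=.
have : (fine (\int[mu]_x (`|h k x| `^ p)%:E) <= e `^ p)%R.
  near: k; have /cvgrPdist_le/(_ _ e1) := ih; apply: filterS => k.
  by rewrite sub0r normrN => /(le_trans (ler_norm _)).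
have p1 : (0 <= p^-1)%R by rewrite invr_ge0 ltW.
move/(ge0_ler_powR p1) => /(_ _ _)/le_trans; apply.
- by rewrite nnegrE fine_ge0// integral_ge0// => x _; rewrite lee_fin powR_ge0.
- by rewrite nnegrE powR_ge0.
by rewrite -powRrM mulfV ?gt_eqF// powRr1// ltW.
Unshelve. all: by end_near.
Qed.

Lemma Lfun_le p f g : (0 < p)%R -> measurable_fun setT f -> g \in Lfun mu p%:E ->
  (forall x, `|f x| <= `|g x|)%R -> f \in Lfun mu p%:E.
Proof.
move=> p0 mf gL fg; have mg := Lfun_measurable gL.
rewrite inE; apply/andP; split; rewrite inE//=.
have := LnormrE gL; rewrite /finite_norm unlock /= => E.
apply: poweR_lty; apply: (@le_lt_trans _ _ (\int[mu]_x (`|g x| `^ p)%:E)).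
  apply: ge0_le_integral => //.
  - apply/measurable_EFinP; apply: (measurableT_comp (measurable_powR _)).
    exact: measurableT_comp.
  - apply/measurable_EFinP; apply: (measurableT_comp (measurable_powR _)).
    exact: measurableT_comp.
  - move=> x _; rewrite lee_fin; apply: ge0_ler_powR; rewrite ?nnegrE//.
    exact: ltW.
apply: (@lty_poweRy _ _ p^-1); first by rewrite gt_eqF// invr_gt0.
by rewrite E ltry.
Qed.

End Lfun_facts.

(** * Translations and correlations *)

Section translation.
Context {R : realType} {n : nat}.
Local Open Scope ereal_scope.
Local Notation mu := (@lebesgue_rV R n).

Lemma measurable_translate (y : 'rV[R]_n) :
  measurable_fun setT (fun x : 'rV[R]_n => x + y)%R.
Proof.
rewrite [X in measurable_fun _ X](_ : _ = fun x : 'rV[R]_n => 1 *: x + y)%R.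
  exact: measurable_rV_affine.
by apply/funext => x; rewrite scale1r.
Qed.

Lemma ge0_integral_translate (y : 'rV[R]_n) (g : 'rV[R]_n -> \bar R) :
  measurable_fun setT g -> (forall x, 0 <= g x) ->
  \int[mu]_x g (x + y)%R = \int[mu]_x g x.
Proof.
move=> mg g0; rewrite [RHS](ge0_integral_rV_affine y ltr01)//.
by rewrite expr1n mul1e; apply: eq_integral => x _; rewrite scale1r.
Qed.

Lemma integral_translate (y : 'rV[R]_n) (g : 'rV[R]_n -> \bar R) :
  measurable_fun setT g -> \int[mu]_x g (x + y)%R = \int[mu]_x g x.
Proof.
move=> mg; rewrite [LHS]integralE [RHS]integralE.
under eq_integral do rewrite (funepos_comp g (fun x => x + y)%R)/=.
under [X in _ - X = _]eq_integral do rewrite (funeneg_comp g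
  (fun x => x + y)%R)/=.
rewrite (ge0_integral_translate y (measurable_funepos mg))//.
by rewrite (ge0_integral_translate y (measurable_funeneg mg)).
Qed.

Lemma Lnorm_translate p y (v : 'rV[R]_n -> R) : measurable_fun setT v ->
  'N[mu]_p%:E[EFin \o (fun x => v (x + y))%R] = 'N[mu]_p%:E[EFin \o v].
Proof.
move=> mv; rewrite unlock; congr (_ `^ _).
rewrite -[RHS](ge0_integral_translate y)//.
  apply/measurable_EFinP; apply: (measurableT_comp (measurable_powR _)).
  exact: measurableT_comp.
by move=> x; exact: poweR_ge0.
Qed.

Lemma Lnormr_translate p y (v : 'rV[R]_n -> R) : measurable_fun setT v ->
  Lnormr mu p (fun x => v (x + y))%R = Lnormr mu p v.
Proof. by move=> mv; rewrite /Lnormr Lnorm_translate. Qed.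

Lemma Lfun_translate p y (v : 'rV[R]_n -> R) : v \in Lfun mu p%:E ->
  (fun x => v (x + y))%R \in Lfun mu p%:E.
Proof.
move=> vp; have mv := Lfun_measurable vp.
rewrite inE; apply/andP; split; rewrite inE/=.
  by apply: (measurableT_comp mv); exact: measurable_translate.
rewrite /finite_norm Lnorm_translate//.
by rewrite (LnormrE vp) ltry.
Qed.

End translation.

Section correlation.
Context {R : realType} {n : nat}.
Local Notation mu := (@lebesgue_rV R n).
Implicit Types (u v : 'rV[R]_n -> R) (x y : 'rV[R]_n).

(** The convolution of [v] with the reflection of [u]: the pairing of [u] with
the translate of [v] by [y]. *)
Definition corr u v y : R := \int[mu]_x (u x * v (x + y)).

Variables p q : R.
Hypotheses (p1 : 1 < p) (q1 : 1 < q) (pq : p^-1 + q^-1 = 1).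

Let p0 : 0 < p. Proof. exact: lt_trans p1. Qed.
Let q0 : 0 < q. Proof. exact: lt_trans q1. Qed.

Lemma corr_integrable u v y : u \in Lfun mu q%:E -> v \in Lfun mu p%:E ->
  mu.-integrable setT (fun x => (u x * v (x + y))%:E).
Proof.
by move=> uq vp; exact: (hoelder_integrable p0 q0 pq uq (Lfun_translate y vp)).
Qed.

Lemma corr_le u v y : u \in Lfun mu q%:E -> v \in Lfun mu p%:E ->
  `|corr u v y| <= Lnormr mu q u * Lnormr mu p v.
Proof.
move=> uq vp; rewrite -(Lnormr_translate p y (Lfun_measurable vp)).
exact: (Rintegral_hoelder p0 q0 pq uq (Lfun_translate y vp)).
Qed.

Lemma corrP u v v' (a : R) y : u \in Lfun mu q%:E ->
  v \in Lfun mu p%:E -> v' \in Lfun mu p%:E ->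
  corr u (a *: v + v') y = a * corr u v y + corr u v' y.
Proof.
move=> uq vp vp'.
rewrite /corr -RintegralZl//; last exact: corr_integrable.
rewrite -RintegralD//; last 2 first.
- rewrite [X in _.-integrable _ X](_ : _ = fun x => a%:E * (u x * v
    (x + y))%:E)%E//.
  by apply: integrableZl => //; exact: corr_integrable.
- exact: corr_integrable.
apply: eq_Rintegral => x _ /=.
rewrite [X in u x * X](_ : _ = a * v (x + y) + v' (x + y))//.
by rewrite mulrDr mulrCA.
Qed.

End correlation.

(** * Continuity of correlations *)

Section continuity.
Context {R : realType} {n : nat}.
Local Notation mu := (@lebesgue_rV R n).
Implicit Types (v w : 'rV[R]_n -> R) (x : 'rV[R]_n) (A : set 'rV[R]_n).

Variables p q : R.
Hypotheses (p1 : 1 < p) (q1 : 1 < q) (pq : p^-1 + q^-1 = 1).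

Variables (u : 'rV[R]_n -> R) (y_ : nat -> 'rV[R]_n) (C : R).
Hypotheses (uq : u \in Lfun mu q%:E)
  (y0 : forall i, (y_ k 0 i) @[k --> \oo] --> (0 : R))
  (yC : forall k, sqnorm (y_ k) <= C).

Let p0 : 0 < p. Proof. exact: lt_trans p1. Qed.
Let q0 : 0 < q. Proof. exact: lt_trans q1. Qed.
Let p1' : (1 <= p%:E)%E. Proof. by rewrite lee_fin ltW. Qed.

(** Continuity at [0] of the correlation of [u] and [v], along the fixed
sequence [y_].  The functions [v] with this property form a vector space which
is closed under dominated limits; together with the pointwise continuous
functions dominated by a Gaussian this exhausts [L^p]. *)
Definition corr_cont v := v \in Lfun mu p%:E /\
  corr u v (y_ k) @[k --> \oo] --> corr u v 0.

Lemma Lfun_lin (a : R) v w : v \in Lfun mu p%:E -> w \in Lfun mu p%:E ->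
  a *: v + w \in Lfun mu p%:E.
Proof. by case: (Lfun_submod_closed mu p1') => _; exact. Qed.

Lemma corr_cont_lin (a : R) v w : corr_cont v -> corr_cont w -> corr_cont
  (a *: v + w).
Proof.
move=> [vp cv] [wp cw]; split; first exact: Lfun_lin.
rewrite (corrP p1 q1 pq _ _ uq)//.
under eq_fun do rewrite (corrP p1 q1 pq _ _ uq)//.
by apply: cvgD => //; apply: cvgM => //; exact: cvg_cst.
Qed.

Lemma corr_cont0 : corr_cont 0.
Proof.
have z : (0 : 'rV[R]_n -> R) \in Lfun mu p%:E by case:
  (Lfun_submod_closed mu p1').
split => //; rewrite /corr.
under eq_fun do under eq_Rintegral do rewrite mulr0.
by under eq_Rintegral do rewrite mulr0; exact: cvg_cst.
Qed.

(** By Hoelder's inequality [corr u (v_ k)] tends to [corr u v] uniformly on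
the whole space, and a uniform limit preserves continuity. *)
Lemma corr_cont_limit (v_ : nat -> 'rV[R]_n -> R) v (V : 'rV[R]_n -> R) :
  (forall k, corr_cont (v_ k)) -> measurable_fun setT v -> V \in Lfun mu p%:E ->
  (forall k x, `|v_ k x| <= `|V x|) -> (forall x, v_ ^~ x @ \oo --> v x) ->
  corr_cont v.
Proof.
move=> gv mv VL vV vcv.
have vleV x : `|v x| <= `|V x|.
  have : `|v_ k x| @[k --> \oo] --> `|v x| by exact: cvg_norm (vcv x).
  move=> /cvg_lim <- //; apply: limr_le; last by apply: nearW => k; exact: vV.
  by apply: cvgP; exact: cvg_norm (vcv x).
have vp : v \in Lfun mu p%:E by exact: (Lfun_le p0 mv VL).
split=> //.
pose h k := (-1) *: v + v_ k.
have hp k : h k \in Lfun mu p%:E by apply: Lfun_lin => //; case: (gv k).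
have hE k x : h k x = v_ k x - v x.
  by rewrite [LHS](_ : _ = -1 * v x + v_ k x)// mulN1r addrC.
have dV : 2 *: V \in Lfun mu p%:E.
  rewrite -[X in X \in _]addr0; apply: Lfun_lin => //.
  by case: (Lfun_submod_closed mu p1').
have hn : Lnormr mu p (h k) @[k --> \oo] --> (0 : R).
  apply: (Lnormr_dct p0 _ dV) => //.
  - by move=> k; exact: Lfun_measurable (hp k).
  - move=> k x; rewrite hE (le_trans (ler_normB _ _))//.
    rewrite [X in _ <= `|X|](_ : _ = 2 * V x)// normrM ger0_norm//.
    by rewrite mulr_natl mulr2n lerD.
  - move=> x; under eq_fun do rewrite hE.
    by rewrite -(subrr (v x)); apply: cvgB => //; exact: cvg_cst.
have hb k y : `|corr u (v_ k) y - corr u v y| <= Lnormr mu q u * Lnormr mu p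
  (h k).
  rewrite (_ : _ - _ = corr u (h k) y); first exact: (corr_le p1 q1 pq).
  by rewrite (corrP p1 q1 pq _ _ uq)// ?mulN1r 1?addrC//; case: (gv k).
have hn' : Lnormr mu q u * Lnormr mu p (h k) @[k --> \oo] --> (0 : R).
  by rewrite -(mulr0 (Lnormr mu q u)); apply: cvgM => //; exact: cvg_cst.
apply/cvgrPdist_le => e e0.
have e3 : 0 < e / 3 by rewrite divr_gt0.
have /cvgrPdist_le/(_ _ e3) [j _ /(_ j (leqnn j))] := hn'.
rewrite sub0r normrN => jh.
have {}jh : Lnormr mu q u * Lnormr mu p (h j) <= e / 3.
  by apply: le_trans jh; exact: ler_norm.
have [_ /cvgrPdist_le/(_ _ e3)] := gv j.
apply: filterS => k kh.
have := hb j 0; have := hb j (y_ k).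
move: (corr u v 0) (corr u v (y_ k)) (corr u (v_ j) 0) (corr u (v_ j)
  (y_ k)) kh jh => a b c d.
rewrite !ler_norml => *; lra.
Qed.

Lemma cvg_sqnorm x : sqnorm (x + y_ k) @[k --> \oo] --> sqnorm x.
Proof.
rewrite /sqnorm.
apply: cvg_big => [|i _]; first exact: add_continuous.
under eq_fun do rewrite mxE.
have h : x 0 i + y_ k 0 i @[k --> \oo] --> x 0 i.
  by rewrite -[X in _ --> X]addr0; apply: cvgD => //; exact: cvg_cst.
by apply: cvgM.
Qed.

Lemma cvg_gaussian c x : gaussian c (x + y_ k) @[k --> \oo] --> gaussian c x.
Proof.
apply: (@continuous_cvg _ _ _ \oo _ (fun k => - c * sqnorm (x + y_ k)) expR).
  exact: continuous_expR.
by apply: cvgM; [exact: cvg_cst|exact: cvg_sqnorm].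
Qed.

Lemma Lfun_gaussian c : 0 < c -> gaussian c \in Lfun mu p%:E.
Proof.
move=> c0; apply: (@Lfun_gaussian_dom _ _ p 1 c) => //;
  first exact: measurable_gaussian.
by move=> x; rewrite mul1r ger0_norm// gaussian_ge0.
Qed.

(** Dominated convergence: since [y_] is bounded, a wider Gaussian dominates
all the translates of [v] at once. *)
Lemma corr_cont_pointwise v : measurable_fun setT v ->
  (forall x, `|v x| <= gaussian 1 x) ->
  (forall x, v (x + y_ k) @[k --> \oo] --> v x) -> corr_cont v.
Proof.
move=> mv vg vc; split.
  by apply: (Lfun_le p0 mv (Lfun_gaussian ltr01)) => x;
    rewrite [leRHS]ger0_norm ?gaussian_ge0.
pose W x := expR C * gaussian 2^-1 x.
have WL : W \in Lfun mu p%:E.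
  apply: (@Lfun_gaussian_dom _ _ p (expR C) 2^-1) => //.
    by apply: measurable_funM => //; exact: measurable_gaussian.
  by move=> x; rewrite ger0_norm// mulr_ge0 ?expR_ge0 ?gaussian_ge0.
have vW k x : `|v (x + y_ k)| <= W x.
  rewrite (le_trans (vg _))// (le_trans (gaussianD _ _ ltr01))// !mul1r.
  by rewrite /W ler_wpM2r ?gaussian_ge0// ler_expR.
have mu_ := Lfun_measurable uq.
have iuW : mu.-integrable setT (fun x => (`|u x| * W x)%:E).
  have := hoelder_integrable p0 q0 pq uq WL.
  move=> /integrable_abse; apply: eq_integrable => // x _ /=.
  by rewrite normrM [X in _ * X]ger0_norm// mulr_ge0 ?expR_ge0 ?gaussian_ge0.
have vp : v \in Lfun mu p%:E.
  by apply: (Lfun_le p0 mv (Lfun_gaussian ltr01)) => x;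
    rewrite [leRHS]ger0_norm ?gaussian_ge0.
rewrite /corr /Rintegral; apply: fine_cvg; rewrite fineK; last first.
  by apply: integrable_fin_num => //; exact: (corr_integrable p1 q1 pq).
apply: (@dominated_cvg _ _ _ mu _ measurableT _ _ (fun x =>
  (`|u x| * W x)%:E)) => //.
- move=> k; apply/measurable_EFinP; apply: measurable_funM => //.
  by apply: (measurableT_comp mv); exact: measurable_translate.
- move=> x _; apply: cvg_EFin; first exact: nearW.
  by apply: cvgM; [exact: cvg_cst|rewrite addr0; exact: vc].
- by move=> k x _; rewrite lee_fin normrM ler_wpM2l.
Qed.

End continuity.

Section density.
Context {R : realType} {n : nat}.
Local Notation mu := (@lebesgue_rV R n).
Implicit Types (v w : 'rV[R]_n -> R) (x : 'rV[R]_n) (A : set 'rV[R]_n).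

Variables p q : R.
Hypotheses (p1 : 1 < p) (q1 : 1 < q) (pq : p^-1 + q^-1 = 1).

Variables (u : 'rV[R]_n -> R) (y_ : nat -> 'rV[R]_n) (C : R).
Hypotheses (uq : u \in Lfun mu q%:E)
  (y0 : forall i, (y_ k 0 i) @[k --> \oo] --> (0 : R))
  (yC : forall k, sqnorm (y_ k) <= C).

Let p0 : 0 < p. Proof. exact: lt_trans p1. Qed.
Let p1' : (1 <= p%:E)%E. Proof. by rewrite lee_fin ltW. Qed.

Local Notation corr_cont := (corr_cont p u y_).

(** Sets whose indicator is a pointwise limit of functions that are continuous
along [y_].  They contain the open half-spaces and are stable under
intersection, hence they form a pi-system generating the Borel sets. *)
Definition approximable A := measurable A /\
  exists c : nat -> 'rV[R]_n -> R,
    [/\ forall j, measurable_fun setT (c j), forall j x, 0 <= c j x <= 1,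
        forall j x, c j (x + y_ k) @[k --> \oo] --> c j x &
        forall x, c j x @[j --> \oo] --> (\1_A x : R)].

Lemma approximable_setT : approximable setT.
Proof.
split=> //; exists (fun _ => cst 1); split=> //.
- by move=> j x; rewrite ler01 lexx.
- by move=> j x; exact: cvg_cst.
- by move=> x; rewrite indicT; exact: cvg_cst.
Qed.

Lemma approximable_setI : setI_closed approximable.
Proof.
move=> A B [mA [a [ma a01 ay aA]]] [mB [b [mb b01 yb bB]]].
split; first exact: measurableI.
exists (fun j x => a j x * b j x); split.
- by move=> j; exact: measurable_funM.
- move=> j x; have /andP[a0 a1] := a01 j x; have /andP[b0 b1] := b01 j x.
  by rewrite mulr_ge0//= mulr_ile1.
- by move=> j x; apply: cvgM.
- by move=> x; rewrite indicI; apply: cvgM.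
Qed.

(** With [s = (x_i - a) + |x_i - a|], which is positive exactly on the
half-space, the indicator is the limit of [1 - exp(- j s)]. *)
Lemma approximable_ray i (a : R) : approximable [set x | a < x 0 i].
Proof.
have mi : measurable_fun setT (fun x => x 0 i) by exact: measurable_rV_coord.
split.
  rewrite [X in measurable X](_ : _ = setT `&`
    (fun x => x 0 i) @^-1` `]a, +oo[%classic); last first.
    by rewrite setTI; apply/seteqP; split=> x /=; rewrite in_itv/= andbT.
  exact: mi.
pose z x := expR (- ((x 0 i - a) + `|x 0 i - a|)).
have z01 x : 0 <= z x <= 1.
  rewrite expR_ge0 -expR0 ler_expR oppr_le0.
  by have := ler_norm (a - x 0 i); rewrite distrC; lra.
exists (fun j x => 1 - z x ^+ j); split.
- move=> j; apply: measurable_funB => //; apply: measurable_funX.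
  apply: measurableT_comp => //; apply: measurable_funN.
  have mia : measurable_fun setT (fun x => x 0 i - a) by exact: measurable_funB.
  by apply: measurable_funD => //; exact: measurableT_comp.
- move=> j x; have /andP[z0 z1] := z01 x.
  by rewrite subr_ge0 gerBl exprn_ge0// exprn_ile1.
- move=> j x; apply: cvgB; first exact: cvg_cst.
  apply: (continuous_cvg _ (@exprn_continuous R j _)).
  apply: (continuous_cvg _ (@continuous_expR R _)).
  have h : (x + y_ k) 0 i - a @[k --> \oo] --> x 0 i - a.
    under eq_cvg do rewrite mxE; apply: cvgB; last exact: cvg_cst.
    by rewrite -[X in _ --> X]addr0; apply: cvgD => //; exact: cvg_cst.
  by apply: cvgN; apply: cvgD => //; exact: cvg_norm.
- move=> x; rewrite indicE.
  have [ax|xa] := ltP a (x 0 i).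
    rewrite mem_set//= -[X in _ --> X]subr0; apply: cvgB; first exact: cvg_cst.
    apply: cvg_expr; rewrite ger0_norm ?expR_ge0// -[ltRHS]expR0 ltr_expR.
    by rewrite oppr_lt0 addr_gt0 ?normr_gt0 ?subr_gt0// gt_eqF ?subr_gt0.
  rewrite memNset/=; last by apply/negP; rewrite -leNgt.
  rewrite -[X in _ --> X](subrr 1); apply: cvgB; first exact: cvg_cst.
  rewrite /z ler0_norm ?subr_le0// subrr oppr0 expR0.
  by apply: cvg_near_cst; apply: nearW => j; rewrite expr1n.
Qed.

Lemma measurable_approximable : @measurable _ 'rV[R]_n = <<s approximable >>.
Proof.
apply/seteqP; split => [A mA|A]; last first.
  by apply: smallest_sub; [exact: sigma_algebra_measurable|move=> B []].
apply: (smallest_sub _ _ mA); first exact: smallest_sigma_algebra.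
move=> B; rewrite -bigcup_seq/= => -[i _ [D mD <-]].
pose T' := g_sigma_algebraType approximable.
have : @measurable_fun _ _ T' (measurableTypeR R) setT (fun x : T' => x 0 i).
  apply: (@measurability _ _ T' (measurableTypeR R) setT _ (@RGenOInfty.G R)).
    exact: RGenOInfty.measurableE.
  move=> _ [_ [a ->] <-]; apply: sub_sigma_algebra; rewrite setTI.
  have := approximable_ray i a; congr approximable.
  by apply/seteqP; split=> x /=; rewrite in_itv/= andbT.
by apply => //.
Qed.

(** The Gaussian weight keeps the indicators of sets of infinite measure
inside [L^p]. *)
Definition corr_cont_set A := corr_cont (fun x => gaussian 1 x * \1_A x).

Lemma corr_cont_approximable A : approximable A -> corr_cont_set A.
Proof.
move=> [mA [c [mc c01 cy cA]]].
have mg1 := @measurable_gaussian R n 1.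
apply: (corr_cont_limit p1 q1 pq uq (v_ := fun j x => gaussian 1 x * c j x)
  (V := gaussian 1)).
- move=> j; apply: (corr_cont_pointwise p1 q1 pq uq yC).
  + exact: measurable_funM.
  + move=> x; have /andP[c0 c1] := c01 j x.
    by rewrite normrM !ger0_norm ?gaussian_ge0// ler_piMr ?gaussian_ge0.
  + by move=> x; apply: cvgM => //; exact: cvg_gaussian.
- by apply: measurable_funM.
- exact: Lfun_gaussian.
- move=> j x; have /andP[c0 c1] := c01 j x.
  by rewrite normrM !ger0_norm ?gaussian_ge0// ler_piMr ?gaussian_ge0.
- by move=> x; apply: cvgM => //; exact: cvg_cst.
Qed.

Lemma corr_cont_set_measurable A : measurable A -> corr_cont_set A.
Proof.
rewrite measurable_approximable.
have mg1 := @measurable_gaussian R n 1.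
apply: (dynkin_induction measurable_approximable approximable_setI).
- exact/corr_cont_approximable/approximable_setT.
- exact: corr_cont_approximable.
- move=> B mB gB; rewrite /corr_cont_set.
  rewrite (_ : (fun _ => _) = (-1) *: (fun x => gaussian 1 x * \1_B x) +
      (fun x => gaussian 1 x * \1_setT x)).
    apply: (corr_cont_lin p1 q1 pq uq) => //.
    exact/corr_cont_approximable/approximable_setT.
  apply/funext => x.
  rewrite [RHS](_ : _ = -1 * (gaussian 1 x * \1_B x) + gaussian 1 x * \1_setT
    x)//.
  rewrite !indicE in_setC in_setT; case: (x \in B) => /=; ring.
- move=> F mF tF gF.
  (* The sets [F i] are disjoint, so at most one term is nonzero. *)
  have sumE x : (exists2 i, F i x &
        forall j, \sum_(l < j) (\1_(F l) x : R) = (i < j)%N%:R) \/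
      (forall i, ~ F i x).
    have [[i Fix]|nF] := pselect (exists i, F i x); last first.
      by right => i Fix; apply: nF; exists i.
    left; exists i => // j.
    have z l : l != i -> \1_(F l) x = 0 :> R.
      move=> li; rewrite indicE memNset// => Flx.
      by move/trivIsetP : tF => /(_ l i I I li)/seteqP[+ _] => /(_ x); apply.
    case: ltnP => ij.
      rewrite (bigD1 (Ordinal ij))//= big1 ?addr0 => [|l li];
        first by rewrite indicE mem_set.
      by apply: z; apply: contra li => /eqP li; apply/eqP/val_inj.
    rewrite big1// => l _; apply: z; apply: contraTneq (ltn_ord l) => ->.
    by rewrite -leqNgt.
  apply: (corr_cont_limit p1 q1 pq uq (V := gaussian 1)
    (v_ := fun j x => \sum_(i < j) gaussian 1 x * \1_(F i) x)).
  + move=> j; elim: j => [|j ih].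
      rewrite (_ : (fun _ => _) = 0); first exact: corr_cont0.
      by apply/funext => x; rewrite big_ord0.
    suff -> : (fun x => \sum_(i < j.+1) gaussian 1 x * \1_(F i) x) =
        1 *: (fun x => gaussian 1 x * \1_(F j) x) +
        (fun x => \sum_(i < j) gaussian 1 x * \1_(F i) x).
      exact: (corr_cont_lin p1 q1 pq uq 1 (gF j) ih).
    by apply/funext => x; rewrite big_ord_recr/= addrC scale1r.
  + apply: measurable_funM => //; apply: measurable_indic.
    exact: bigcup_measurable.
  + exact: Lfun_gaussian.
  + move=> j x; rewrite -mulr_sumr normrM -[leRHS]mulr1 ler_wpM2l//.
    have [[i _ ->]|nF] := sumE x; first by rewrite normr_nat lern1 leq_b1.
    by rewrite big1 ?normr0// => i _; rewrite indicE memNset.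
  + move=> x; under eq_fun do rewrite -mulr_sumr.
    apply: cvgM; first exact: cvg_cst.
    have [[i Fi h]|nF] := sumE x.
      rewrite indicE mem_set; last by exists i.
      under eq_fun do rewrite h.
      apply: cvg_near_cst; near=> j; rewrite (_ : (i < j)%N)//.
      by near: j; exact: nbhs_infty_gt.
    rewrite indicE memNset; last by move=> -[i _ /nF].
    rewrite (_ : (fun _ => _) = cst 0); first exact: cvg_cst.
    by apply/funext => j; rewrite big1// => i _; rewrite indicE memNset.
Unshelve. all: by end_near.
Qed.

Import HBNNSimple.

Lemma corr_cont_nnsfun (s : {nnsfun 'rV[R]_n >-> R}) : corr_cont
  (fun x => gaussian 1 x * s x).
Proof.
rewrite (_ : (fun _ => _) =
    \sum_(r <- finmap.enum_fset (fset_set (range s))) r *: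
      (fun x => gaussian 1 x * \1_(s @^-1` [set r]) x)); last first.
  apply/funext => x; rewrite fct_sumE fimfunE fsbig_finite//= mulr_sumr.
  by apply: eq_bigr => r _; rewrite mulrCA.
elim: (finmap.enum_fset _) => [|r l ih]; first by rewrite big_nil;
  exact: corr_cont0.
by rewrite big_cons; apply: (corr_cont_lin p1 q1 pq uq) => //;
  exact: corr_cont_set_measurable.
Qed.

(** [v] is the Gaussian times [v exp(|x|^2)], and the latter is an increasing
limit of simple functions. *)
Lemma corr_cont_ge0 v : v \in Lfun mu p%:E -> (forall x, 0 <= v x) -> corr_cont v.
Proof.
move=> vp v0; have mv := Lfun_measurable vp.
pose f x := (v x * expR (sqnorm x))%:E.
have gE x : gaussian 1 x * expR (sqnorm x) = 1.
  by rewrite /gaussian mulN1r expRN mulVf// gt_eqF ?expR_gt0.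
have f0 x : (0 <= f x)%E by rewrite lee_fin mulr_ge0// expR_ge0.
have mf : measurable_fun setT f.
  apply/measurable_EFinP; apply: measurable_funM => //.
  rewrite (_ : (fun _ => _) = gaussian (-1)); first exact: measurable_gaussian.
  by apply/funext => x; rewrite /gaussian opprK mul1r.
pose s := nnsfun_approx measurableT mf.
have sv k x : s k x <= v x * expR (sqnorm x).
  by rewrite -lee_fin /s nnsfun_approxE; exact: le_approx.
apply: (corr_cont_limit p1 q1 pq uq (V := v)
  (v_ := fun k x => gaussian 1 x * s k x)) => //.
- by move=> k; exact: corr_cont_nnsfun.
- move=> k x; rewrite !ger0_norm// ?mulr_ge0 ?gaussian_ge0//.
  rewrite (le_trans (ler_wpM2l (gaussian_ge0 _ _) (sv k x)))//.
  by rewrite mulrCA gE mulr1.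
- move=> x; have -> : v x = gaussian 1 x * (v x * expR (sqnorm x)).
    by rewrite mulrCA gE mulr1.
  apply: cvgM; first exact: cvg_cst.
  by have /fine_cvg := cvg_nnsfun_approx measurableT mf (fun x _ => f0 x)
    (I : setT x); exact.
Qed.

Lemma cvg_corr v : v \in Lfun mu p%:E ->
  corr u v (y_ k) @[k --> \oo] --> corr u v 0.
Proof.
move=> vp; have mv := Lfun_measurable vp.
suff [] : corr_cont v by [].
rewrite (_ : v = (-1) *: (fun x => Num.max (- v x) 0) + (fun x => Num.max
  (v x) 0)).
  apply: (corr_cont_lin p1 q1 pq uq); apply: corr_cont_ge0.
  - apply: (Lfun_le p0 _ vp); first by apply: measurable_maxr => //;
      exact: measurable_funN.
    move=> x; rewrite ger0_norm ?le_max ?lexx ?orbT// ge_max normr_ge0 andbT.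
    by rewrite -normrN ler_norm.
  - by move=> x; rewrite le_max lexx orbT.
  - apply: (Lfun_le p0 _ vp); first exact: measurable_maxr.
    move=> x; rewrite ger0_norm ?le_max ?lexx ?orbT// ge_max normr_ge0 andbT.
    exact: ler_norm.
  - by move=> x; rewrite le_max lexx orbT.
apply/funext => x.
rewrite [RHS](_ : _ = -1 * Num.max (- v x) 0 + Num.max (v x) 0)//.
by case: (leP 0 (v x)) => h; case: (leP (- v x) 0) => h'; lra.
Qed.

End density.

(** * Decay of correlations *)

Section decay.
Context {R : realType} {n : nat}.
Local Notation mu := (@lebesgue_rV R n).
Implicit Types (u v w : 'rV[R]_n -> R) (x y : 'rV[R]_n) (A : set 'rV[R]_n).

Variables p q : R.
Hypotheses (p1 : 1 < p) (q1 : 1 < q) (pq : p^-1 + q^-1 = 1).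

Let p0 : 0 < p. Proof. exact: lt_trans p1. Qed.
Let q0 : 0 < q. Proof. exact: lt_trans q1. Qed.

Definition cutoff (A : set 'rV[R]_n) (u : 'rV[R]_n -> R) x : R := u x * \1_A x.

Lemma measurable_cutoff A u : measurable A -> measurable_fun setT u ->
  measurable_fun setT (cutoff A u).
Proof. by move=> mA mu_; apply: measurable_funM. Qed.

Lemma cutoff_le A u x : `|cutoff A u x| <= `|u x|.
Proof. by rewrite /cutoff indicE normrM; case: (x \in A);
  rewrite ?normr1 ?normr0 ?mulr1 ?mulr0. Qed.

Lemma Lfun_cutoff (r : R) A u : 0 < r -> measurable A -> u \in Lfun mu r%:E ->
  cutoff A u \in Lfun mu r%:E.
Proof.
move=> r0 mA ur; apply: (Lfun_le r0 _ ur); last exact: cutoff_le.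
exact: measurable_cutoff (Lfun_measurable ur).
Qed.

Lemma Lnormr_cutoff_cvg0 (r : R) (A : nat -> set 'rV[R]_n) u : 0 < r ->
  (forall m, measurable (A m)) -> u \in Lfun mu r%:E ->
  (forall x, \forall m \near \oo, ~ A m x) ->
  Lnormr mu r (cutoff (A m) u) @[m --> \oo] --> (0 : R).
Proof.
move=> r0 mA ur hA; apply: (Lnormr_dct r0 _ ur).
- by move=> m; exact: measurable_cutoff (Lfun_measurable ur).
- by move=> m x; exact: cutoff_le.
- move=> x; apply: cvg_near_cst; apply: filterS (hA x) => m Am.
  by rewrite /cutoff indicE memNset// mulr0.
Qed.

Lemma measurable_coord_le (j : 'I_n)
  (a : R) : measurable [set x : 'rV[R]_n | x 0 j <= a].
Proof.
rewrite [X in measurable X](_ : _ = setT `&` rV_coord j @^-1` `]-oo,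
  a]%classic); last first.
  by rewrite setTI; apply/seteqP; split=> x /=; rewrite in_itv.
exact: measurable_rV_coord.
Qed.

Lemma measurable_coord_gt (j : 'I_n)
  (a : R) : measurable [set x : 'rV[R]_n | a < x 0 j].
Proof.
rewrite [X in measurable X](_ : _ = setT `&` rV_coord j @^-1` `]a,
  +oo[%classic); last first.
  by rewrite setTI; apply/seteqP; split=> x /=; rewrite in_itv/= andbT.
exact: measurable_rV_coord.
Qed.

Lemma near_ltr_nat (a : R) : \forall m \near \oo, a < m%:R / 2.
Proof.
near=> m; rewrite ltr_pdivlMr//.
by near: m; exact: nbhs_infty_gtr.
Unshelve. all: by end_near.
Qed.

(** Let [A] be the half-space [x_j <= - m / 2] and [B] the half-space
[m / 2 + y_j < x_j].  If [x] is not in [A] then its translate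
[x + y + m e_j] is in [B], so that
[corr u v = corr u_A v + corr u v_B - corr u_A v_B] at [y + m e_j].  Each term
is small, because [A] and [B] leave every bounded set. *)
Lemma corr_cvg0 u v (j : 'I_n) y : u \in Lfun mu q%:E -> v \in Lfun mu p%:E ->
  corr u v (y + m%:R *: 'e_j) @[m --> \oo] --> (0 : R).
Proof.
move=> uq vp.
pose A m := [set x : 'rV[R]_n | x 0 j <= - (m%:R / 2)].
pose B m := [set x : 'rV[R]_n | m%:R / 2 + y 0 j < x 0 j].
have mA m : measurable (A m) by exact: measurable_coord_le.
have mB m : measurable (B m) by exact: measurable_coord_gt.
have uA m := Lfun_cutoff q0 (mA m) uq.
have vB m := Lfun_cutoff p0 (mB m) vp.
have uA0 : Lnormr mu q (cutoff (A m) u) @[m --> \oo] --> (0 : R).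
  apply: Lnormr_cutoff_cvg0 => // x; near=> m => /=; apply/negP;
    rewrite -ltNge ltrNl.
  by near: m; exact: near_ltr_nat.
have vB0 : Lnormr mu p (cutoff (B m) v) @[m --> \oo] --> (0 : R).
  apply: Lnormr_cutoff_cvg0 => // x; near=> m => /=; apply/negP;
    rewrite -leNgt -lerBlDr ltW//.
  by near: m; exact: near_ltr_nat.
pose b m := Lnormr mu q (cutoff (A m) u) * Lnormr mu p v +
  Lnormr mu q u * Lnormr mu p (cutoff (B m) v) +
  Lnormr mu q (cutoff (A m) u) * Lnormr mu p (cutoff (B m) v).
have b0 : b m @[m --> \oo] --> (0 : R).
  rewrite (_ : 0 = 0 * Lnormr mu p v + Lnormr mu q u * 0 + 0 * 0); last by ring.
  by apply: cvgD; [apply: cvgD|]; apply: cvgM => //; exact: cvg_cst.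
apply/norm_cvg0P; apply: (squeeze_cvgr _ _ b0); last exact: (cvg_cst (0 : R)).
apply: nearW => m; rewrite normr_ge0/=.
have -> : corr u v (y + m%:R *: 'e_j) =
    corr (cutoff (A m) u) v (y + m%:R *: 'e_j) +
    corr u (cutoff (B m) v) (y + m%:R *: 'e_j) -
    corr (cutoff (A m) u) (cutoff (B m) v) (y + m%:R *: 'e_j).
  rewrite /corr -RintegralD//; last 2 first.
  - exact: (corr_integrable p1 q1 pq).
  - exact: (corr_integrable p1 q1 pq).
  rewrite -RintegralB//; last 2 first.
  - rewrite [X in _.-integrable _ X](_ : _ = (fun x => (cutoff (A m) u x * v
      (x + (y + m%:R *: 'e_j)))%:E) \+
      (fun x => (u x * cutoff (B m) v (x + (y + m%:R *: 'e_j)))%:E))%E//.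
    by apply: integrableD => //; exact: (corr_integrable p1 q1 pq).
  - exact: (corr_integrable p1 q1 pq).
  apply: eq_Rintegral => x _; rewrite /cutoff !indicE.
  have [xA|xA] := boolP (x \in A m); rewrite ?mulr1 ?mulr0 ?mul0r /=;
    first by ring.
  rewrite add0r subr0 mem_set ?mulr1//= /B /= !mxE !eqxx /= mulr1.
  move: xA; rewrite notin_setE /A /= => /negP; rewrite -ltNge; lra.
rewrite /b (le_trans (ler_normB _ _))// lerD//; last exact: (corr_le p1 q1 pq).
by rewrite (le_trans (ler_normD _ _))// lerD//; exact: (corr_le p1 q1 pq).
Unshelve. all: by end_near.
Qed.

End decay.

(** * Integrating a correlation against a kernel *)

Section fubini_G.
Context d1 d2 (T1 : measurableType d1) (T2 : measurableType d2) (R : realType).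
Variables (m1 : {sigma_finite_measure set T1 -> \bar R})
  (m2 : {sigma_finite_measure set T2 -> \bar R}).
Local Open Scope ereal_scope.

(** Counterpart of [integrable_fubini_F] for the other partial integral. *)
Lemma integrable_fubini_G (f : T1 * T2 -> \bar R) :
  (m1 \x m2).-integrable setT f -> m2.-integrable setT (fubini_G m1 f).
Proof.
move=> imf; have mf := measurable_int _ imf.
have mG := measurable_fubini_G imf.
apply/integrableP; split=> //.
apply: le_lt_trans ((integrable21ltyP _ _ mf).1 imf).
apply: ge0_le_integral => //.
- exact: measurableT_comp.
- apply: (measurable_fun_fubini_tonelli_G (m1 := m1) (abse \o f)) => /=.
    exact: measurableT_comp.
  by move=> z; exact: abse_ge0.
- move=> y _; apply: le_abse_integral => //.
  by apply: (measurableT_comp mf); exact: pair2_measurable.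
Qed.
End fubini_G.

Section fubini_corr.
Context {R : realType} {n : nat}.
Local Notation mu := (@lebesgue_rV R n).
Implicit Types (x y z : 'rV[R]_n).

Variables p q : R.
Hypotheses (p1 : 1 < p) (q1 : 1 < q) (pq : p^-1 + q^-1 = 1).

Let p0 : 0 < p. Proof. exact: lt_trans p1. Qed.
Let q0 : 0 < q. Proof. exact: lt_trans q1. Qed.
Let qp : q^-1 + p^-1 = 1. Proof. by rewrite addrC. Qed.

Variables (u v g : 'rV[R]_n -> R) (K c : R).
Hypotheses (uq : u \in Lfun mu q%:E) (vp : v \in Lfun mu p%:E).
Hypotheses (c0 : 0 < c) (mg : measurable_fun setT g)
  (gK : forall x, `|g x| <= K * gaussian c x).

Let mu_ : measurable_fun setT u. Proof. exact: Lfun_measurable uq. Qed.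
Let mv : measurable_fun setT v. Proof. exact: Lfun_measurable vp. Qed.

Lemma measurable_rV_opp : measurable_fun setT (fun x : 'rV[R]_n => - x).
Proof.
apply: measurable_fun_rV => i.
rewrite (_ : _ \o _ = fun x => - rV_coord i x).
  by apply: measurable_funN; exact: measurable_rV_coord.
by apply/funext => x; rewrite /rV_coord /= mxE.
Qed.

Lemma measurable_rV_add : measurable_fun setT
  (fun z : 'rV[R]_n * 'rV[R]_n => z.1 + z.2).
Proof.
apply: measurable_fun_rV => i.
rewrite (_ : _ \o _ = fun z : 'rV[R]_n * 'rV[R]_n => rV_coord i z.1 + rV_coord
  i z.2).
  by apply: measurable_funD; apply: measurableT_comp => //;
    exact: measurable_rV_coord.
by apply/funext => x; rewrite /rV_coord /= mxE.
Qed.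

Lemma measurable_rV_sub : measurable_fun setT
  (fun z : 'rV[R]_n * 'rV[R]_n => z.2 - z.1).
Proof.
apply: measurable_fun_rV => i.
rewrite (_ : _ \o _ = fun z : 'rV[R]_n * 'rV[R]_n => rV_coord i z.2 - rV_coord
  i z.1).
  by apply: measurable_funB; apply: measurableT_comp => //;
    exact: measurable_rV_coord.
by apply/funext => x; rewrite /rV_coord /= !mxE.
Qed.

Let gL r : 0 < r -> g \in Lfun mu r%:E.
Proof. by move=> r0; exact: Lfun_gaussian_dom r0 c0 mg gK. Qed.

Let gNL r : 0 < r -> (fun x => g (- x)) \in Lfun mu r%:E.
Proof.
move=> r0; apply: (@Lfun_gaussian_dom _ _ r K c) => //.
  by apply: (measurableT_comp mg); exact: measurable_rV_opp.
by move=> x; rewrite -(gaussianN c x); exact: gK.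
Qed.

(* [W] is [V] after the change of variable [z = x + y] in the second
   coordinate. *)
Let V (z : 'rV[R]_n * 'rV[R]_n) := (u z.1 * v (z.1 + z.2) * g z.2)%:E.
Let W (z : 'rV[R]_n * 'rV[R]_n) := (u z.1 * v z.2 * g (z.2 - z.1))%:E.

Let mV : measurable_fun [set: 'rV[R]_n * 'rV[R]_n] V.
Proof.
apply/measurable_EFinP; apply: measurable_funM; first apply: measurable_funM.
- exact: measurableT_comp.
- by apply: (measurableT_comp mv); exact: measurable_rV_add.
- exact: measurableT_comp.
Qed.

Let mW : measurable_fun [set: 'rV[R]_n * 'rV[R]_n] W.
Proof.
apply/measurable_EFinP; apply: measurable_funM; first apply: measurable_funM.
- exact: measurableT_comp.
- exact: measurableT_comp.
- by apply: (measurableT_comp mg); exact: measurable_rV_sub.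
Qed.

Lemma integrable_gaussian_dom : mu.-integrable setT (fun y => (g y)%:E).
Proof. by apply/Lfun1_integrable; exact: gL. Qed.

Let iV : (mu \x mu)%E.-integrable setT V.
Proof.
apply/(integrable21ltyP _ _ mV).
have h y : (\int[mu]_x `|V (x, y)| <=
  (Lnormr mu q u * Lnormr mu p v)%:E * `|(g y)%:E|)%E.
  rewrite -(Lnormr_translate p y mv).
  apply: (@le_trans _ _ (\int[mu]_x (`|(u x * v (x + y))%:E| * `|(g y)%:E|))%E).
    rewrite le_eqVlt; apply/orP; left; apply/eqP; apply: eq_integral => x _.
    by rewrite -abseM.
  rewrite ge0_integralZr//; last first.
    apply: measurableT_comp => //; apply/measurable_EFinP;
      apply: measurable_funM => //.
    by apply: (measurableT_comp mv); exact: measurable_translate.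
  rewrite lee_wpmul2r//; exact: (hoelder_le p0 q0 pq uq (Lfun_translate y vp)).
apply: (@le_lt_trans _ _ (\int[mu]_y
  ((Lnormr mu q u * Lnormr mu p v)%:E * `|(g y)%:E|))%E).
  apply: ge0_le_integral => //.
  - by move=> y _; exact: integral_ge0.
  - apply: (measurable_fun_fubini_tonelli_G (m1 := mu) (abse \o V)) => //.
      exact: measurableT_comp.
    by move=> z; exact: abse_ge0.
  - apply: measurable_funeM; apply: measurableT_comp => //.
    by apply/measurable_EFinP; exact: mg.
rewrite ge0_integralZl//.
- apply: lte_mul_pinfty => //; first by rewrite lee_fin mulr_ge0 ?Lnormr_ge0.
  by case/integrableP: integrable_gaussian_dom.
- by apply: measurableT_comp => //; apply/measurable_EFinP; exact: mg.
- by rewrite lee_fin mulr_ge0 ?Lnormr_ge0.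
Qed.

Let iW : (mu \x mu)%E.-integrable setT W.
Proof.
apply/(integrable12ltyP _ _ mW); have /(integrable12ltyP _ _ mV) := iV.
apply: le_lt_trans; rewrite le_eqVlt; apply/orP; left; apply/eqP.
apply: eq_integral => x _.
rewrite -(ge0_integral_translate x)//.
  by apply: eq_integral => y _; rewrite /V /W /= addrK [x + y]addrC.
by apply: measurableT_comp => //; apply: (measurableT_comp mW);
  exact: pair1_measurable.
Qed.

Let VE y : (\int[mu]_x V (x, y) = (corr u v y * g y)%:E)%E.
Proof.
have iuv := corr_integrable p1 q1 pq y uq vp.
rewrite /corr EFinM fineK; last exact: integrable_fin_num.
rewrite -integralZr//.
Qed.

Let WxE x : (\int[mu]_z W (x, z) = (u x * \int[mu]_z (v z * g (z - x)))%:E)%E.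
Proof.
have iv := hoelder_integrable q0 p0 qp vp (Lfun_translate (- x) (gL q0)).
rewrite EFinM /Rintegral fineK; last exact: integrable_fin_num.
rewrite -integralZl//; apply: eq_integral => z _.
by rewrite /W /= -mulrA.
Qed.

Let WzE z : (\int[mu]_x W (x, z) = (v z * \int[mu]_x (u x * g (z - x)))%:E)%E.
Proof.
have gz : (fun x => g (z - x)) \in Lfun mu p%:E.
  have := Lfun_translate (- z) (gNL p0).
  by under eq_fun do rewrite opprD opprK addrC.
have iu := hoelder_integrable p0 q0 pq uq gz.
rewrite EFinM /Rintegral fineK; last exact: integrable_fin_num.
rewrite -integralZl//; apply: eq_integral => x _.
by rewrite /W /= -EFinM mulrAC mulrC mulrA.
Qed.

Lemma integrable_corrM : mu.-integrable setT (fun y => (corr u v y * g y)%:E).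
Proof.
have := integrable_fubini_G iV; apply: eq_integrable => // y _.
by rewrite /fubini_G VE.
Qed.

Lemma integrable_inner_z :
  mu.-integrable setT (fun x => (u x * \int[mu]_z (v z * g (z - x)))%:E).
Proof.
have := integrable_fubini_F iW; apply: eq_integrable => // x _.
by rewrite /fubini_F WxE.
Qed.

Lemma integrable_inner_x :
  mu.-integrable setT (fun z => (v z * \int[mu]_x (u x * g (z - x)))%:E).
Proof.
have := integrable_fubini_G iW; apply: eq_integrable => // z _.
by rewrite /fubini_G WzE.
Qed.

Let VW : (\int[mu]_y \int[mu]_x V (x, y) = \int[mu]_x \int[mu]_z W (x, z))%E.
Proof.
rewrite -(Fubini iV); apply: eq_integral => x _.
rewrite -[RHS](integral_translate x).
  by apply: eq_integral => y _; rewrite /V /W /= addrK [x + y]addrC.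
by apply: (measurableT_comp mW); exact: pair1_measurable.
Qed.

(** The integral of [corr u v] against [g] is the double integral of
[u(x) v(z) g(z - x)]; here [v] is smeared by [g], below [u] is. *)
Lemma integral_corrM_z : \int[mu]_y (corr u v y * g y) =
  \int[mu]_x (u x * \int[mu]_z (v z * g (z - x))).
Proof.
rewrite /Rintegral; congr fine.
under eq_integral do rewrite -VE.
by under [RHS]eq_integral do rewrite -WxE.
Qed.

Lemma integral_corrM_x : \int[mu]_y (corr u v y * g y) =
  \int[mu]_z (v z * \int[mu]_x (u x * g (z - x))).
Proof.
rewrite /Rintegral; congr fine.
have E1 : (\int[mu]_y (corr u v y * g y)%:E = \int[mu]_y \int[mu]_x V (x, y))%E.
  by apply: eq_integral => y _; rewrite VE.
have E2 : (\int[mu]_z (v z * \int[mu]_x (u x * g (z - x)))%:E =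
    \int[mu]_z \int[mu]_x W (x, z))%E.
  by apply: eq_integral => z _; rewrite WzE.
have E3 := Fubini iW.
by rewrite E1 E2 VW.
Qed.

End fubini_corr.

(** * Gaussians are Schwartz functions *)

Section polygauss1.
Context {R : realType}.
Implicit Types (P Q : {poly R}) (c a t : R).

Definition polygauss1 c a P t : R := P.[t - a] * expR (- c * (t - a) ^+ 2).

(** Differentiating [P(t - a) exp(- c (t - a)^2)] replaces [P] by this
polynomial. *)
Definition dpolygauss c P : {poly R} := P^`() - (2 * c) *: ('X * P).

Lemma is_derive_polygauss1 c a P t :
  is_derive t 1 (polygauss1 c a P) (polygauss1 c a (dpolygauss c P) t).
Proof.
have hs : is_derive t 1 (fun s : R => s - a) 1.
  rewrite -[X in is_derive _ _ _ X]subr0.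
  by apply: is_deriveB.
have hP : is_derive t 1 (fun s => P.[s - a]) (P^`().[t - a]).
  rewrite -[X in is_derive _ _ _ X]mulr1.
  exact: (@is_derive1_comp _ (horner P) (fun s => s - a) t _ _
    (is_derive_poly P (t - a)) hs).
have hq : is_derive t 1 (fun s => - c * (s - a) ^+ 2) (- (2 * c * (t - a))).
  have hX := is_deriveX 2 hs.
  have h := is_deriveZ (- c) hX.
  apply: (is_derive_eq h); rewrite /GRing.scale /=; ring.
have hE : is_derive t 1 (fun s => expR (- c * (s - a) ^+ 2))
    (expR (- c * (t - a) ^+ 2) * - (2 * c * (t - a))).
  exact: (@is_derive1_comp _ expR (fun s => - c * (s - a) ^+ 2) t _ _
    (is_derive_expR _) hq).
have h := is_deriveM hP hE.
apply: (is_derive_eq h); rewrite /polygauss1 /dpolygauss !hornerE /GRing.scale /=.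
ring.
Qed.

(** For monomials: [|t|^k <= 1 + (t^2)^(k+1)], and [(c t^2)^(k+1) / (k+1)!] is
a term of the exponential series of [c t^2]. *)
Lemma polygauss1_bounded c P : 0 < c ->
  exists M, forall t, `|P.[t] * expR (- c * t ^+ 2)| <= M.
Proof.
move=> c0.
have mono k t : `|t ^+ k * expR (- c * t ^+ 2)| <= 1 + k.+1`!%:R / c ^+ k.+1.
  have t2 : 0 <= c * t ^+ 2 by rewrite mulr_ge0 ?sqr_ge0// ltW.
  have hk : `|t ^+ k| <= 1 + (t ^+ 2) ^+ k.+1.
    rewrite normrX -real_normK ?num_real//.
    have [t1|t1] := leP `|t| 1.
      by rewrite (@le_trans _ _ 1)// ?exprn_ile1// lerDl exprn_ge0// exprn_ge0.
    rewrite -exprM (@le_trans _ _ (`|t| ^+ (2 * k.+1)))// ?lerDr//.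
    by rewrite ler_eXn2l// mul2n -addnn addSn (leq_trans
      (leqnSn _))// ltnS leq_addr.
  rewrite normrM [X in _ * X]ger0_norm ?expR_ge0//.
  apply: (le_trans (ler_wpM2r (expR_ge0 _) hk)).
  rewrite mulrDl mul1r lerD//; first by rewrite -expR0 ler_expR mulNr oppr_le0.
  rewrite mulNr expRN ler_pdivrMr ?expR_gt0// mulrAC ler_pdivlMr ?exprn_gt0//.
  have := expR_ge1Dxn k t2; rewrite exprMn => h.
  have {}h : c ^+ k.+1 * (t ^+ 2) ^+ k.+1 / k.+1`!%:R <= expR (c * t ^+ 2).
    by apply: le_trans h; rewrite lerDr.
  rewrite ler_pdivrMr ?ltr0n ?fact_gt0// in h.
  by rewrite mulrC [leRHS]mulrC.
exists (\sum_(i < size P) `|P`_i| * (1 + i.+1`!%:R / c ^+ i.+1)) => t.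
rewrite horner_coef mulr_suml (le_trans (ler_norm_sum _ _ _))//.
by apply: ler_sum => i _; rewrite -mulrA normrM ler_wpM2l.
Qed.

End polygauss1.

Section polygauss.
Context {R : realType} {n : nat}.
Implicit Types (P Q : 'I_n -> {poly R}) (c : R) (a x : 'rV[R]_n).

(** Products of one-variable functions of the form above.  This class is
stable under partial derivatives, which act on a single factor. *)
Definition polygauss c a P x : R := \prod_i polygauss1 c (a 0 i) (P i) (x 0 i).

Definition subst_factor P (i : 'I_n) (Q : {poly R}) : 'I_n -> {poly R} :=
  fun j => if j == i then Q else P j.

Lemma differentiable_polygauss c a P x : differentiable (polygauss c a P) x.
Proof.
rewrite /polygauss; elim: (index_enum _) => [|i r ih].
  rewrite (_ : (fun _ => _) = cst 1); first exact: differentiable_cst.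
  by apply/funext => y; rewrite big_nil.
rewrite (_ : (fun _ => _) = (fun y : 'rV[R]_n => polygauss1 c (a 0 i) (P i)
  (y 0 i)) *
   (fun y : 'rV[R]_n => \prod_(j <- r) polygauss1 c (a 0 j) (P j) (y 0 j)));
     last first.
  by apply/funext => y; rewrite big_cons.
apply: differentiableM => //.
apply: (@differentiable_comp _ _ _ _ (fun y : 'rV[R]_n => y 0 i) (polygauss1 c
  (a 0 i) (P i))).
  exact: differentiable_coord.
by apply/derivable1_diffP; apply: ex_derive; exact: is_derive_polygauss1.
Qed.

Lemma partial_polygauss c a P i :
  partial i (polygauss c a P) = polygauss c a (subst_factor P i (dpolygauss c
    (P i))).
Proof.
apply/funext => x; rewrite /partial /derive.
pose K := \prod_(j | j != i) polygauss1 c (a 0 j) (P j) (x 0 j).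
have PE (y : 'rV[R]_n) (Q : {poly R}) : (forall j, j != i -> y 0 j = x 0 j) ->
    polygauss c a (subst_factor P i Q) y = polygauss1 c (a 0 i) Q (y 0 i) * K.
  move=> yx; rewrite /polygauss (bigD1 i)//= /subst_factor eqxx; congr (_ * _).
  by apply: eq_bigr => j ji; rewrite (negbTE ji) yx.
have PE0 : P = subst_factor P i (P i).
  by apply/funext => j; rewrite /subst_factor; case: eqP => [->|].
rewrite PE//.
have := is_derive_polygauss1 c (a 0 i) (P i) (x 0 i) => -[dP <-].
rewrite {1}PE0.
apply/cvg_lim => //.
rewrite [X in X @ _ --> _](_ : _ = fun h => (h^-1 *: ((polygauss1 c (a 0 i)
  (P i) \o shift (x 0 i)) (h *: (1 : R)) -
   polygauss1 c (a 0 i) (P i) (x 0 i))) * K).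
  by apply: cvgM; [exact: dP|exact: cvg_cst].
apply/funext => h /=; rewrite !PE//.
  rewrite [polygauss c a P x](_ : _ = polygauss1 c (a 0 i) (P i) (x 0 i) * K);
    last by rewrite {1}PE0 PE.
  by rewrite !mxE !eqxx -mulrBl -scalerAl /= [in RHS]/GRing.scale/=.
by move=> j ji; rewrite !mxE (negbTE ji) mulr0 add0r.
Qed.

Lemma iter_partial_polygauss c a P s : exists Q, iter_partial s
  (polygauss c a P) = polygauss c a Q.
Proof.
elim: s => [|i s [Q ih]]; first by exists P.
by exists (subst_factor Q i (dpolygauss c (Q i)));
  rewrite /= ih partial_polygauss.
Qed.

Lemma polygauss_schwartz c a P : 0 < c -> polygauss c a P \in schwartz_pred.
Proof.
move=> c0; rewrite inE; split => [s x|b s].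
  by have [Q ->] := iter_partial_polygauss c a P s;
    exact: differentiable_polygauss.
have [Q ->] := iter_partial_polygauss c a P s.
have /choice[M hM] : forall i, exists M, forall t,
    `|t ^+ b i * polygauss1 c (a 0 i) (Q i) t| <= M.
  move=> i; have [M hM] := polygauss1_bounded (('X + (a 0 i)%:P) ^+ b i * Q i) c0.
  exists M => t; have := hM (t - a 0 i).
  by rewrite /polygauss1 mulrA hornerM horner_exp !hornerE subrK; apply.
exists (\prod_i M i) => x.
rewrite /monomial /polygauss -big_split /= normr_prod.
by apply: ler_prod => i _; rewrite normr_ge0/=.
Qed.

End polygauss.

(** * Signs of the exterior algebra and Cartan's formula *)

Section signs.
Context {R : realType} {n : nat}.
Implicit Types (I J K L : {set 'I_n}) (i j l : 'I_n).

(** The sign of [dx_i] wedge [dx_K] with respect to the increasing order, which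
counts the [j] in [K] smaller than [i].  It is the same for [K] and [i |: K],
so it serves both the wedge with [dx_i] and the interior product. *)
Definition ext_sign (i : 'I_n) (K : {set 'I_n}) : R := (-1) ^+ (\sum_(j in K)
  (j < i)%N)%N.

Lemma ext_sign_inversions i K : (-1) ^+ inversions [set i]%SET K = ext_sign i K.
Proof.
rewrite /ext_sign; congr (_ ^+ _); rewrite /inversions.
rewrite -sum1_card (eq_bigl (fun ij : 'I_n * 'I_n => (ij.1 == i) &&
  ((ij.2 \in K) && (ij.2 < i)%N))); last first.
  move=> [a b] /=; rewrite !inE /=; case: eqP => [->|]//=.
rewrite -(pair_big_dep (fun a => a == i) (fun _ b => (b \in K) && (b < i)%N)
  (fun _ _ => 1%N)) /=.
rewrite big_pred1_eq big_mkcondr /=; apply: eq_bigr => j _.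
by case: (j < i)%N.
Qed.

Lemma ext_signU1 i l K : l \notin K -> ext_sign i (l |: K)%SET = (-1) ^+
  (l < i)%N * ext_sign i K.
Proof. by move=> lK; rewrite /ext_sign big_setU1//= exprD. Qed.

Lemma ext_sign_self i K : ext_sign i (i |: K)%SET = ext_sign i K.
Proof.
have [iK|iK] := boolP (i \in K).
  by rewrite (_ : (i |: K)%SET = K)//; apply/finset.setP => j; rewrite !inE;
    case: eqP => [->|].
by rewrite ext_signU1// ltnn mul1r.
Qed.

Lemma ext_signD1 i K : ext_sign i (K :\ i)%SET = ext_sign i K.
Proof.
have [iK|iK] := boolP (i \in K);
  first by rewrite -[in RHS](finset.setD1K iK) ext_sign_self.
by rewrite (_ : (K :\ i)%SET = K)//; apply/finset.setP => j; rewrite !inE;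
  case: eqP => [->|//]; rewrite (negbTE iK).
Qed.

Lemma ext_signK i K : ext_sign i K * ext_sign i K = 1.
Proof. by rewrite /ext_sign -expr2 sqrr_sign. Qed.

Lemma sign_lt_swap i l : i != l -> (-1) ^+ (l < i)%N = - (-1) ^+ (i < l)%N :> R.
Proof.
move=> il; case: ltngtP => [||/val_inj e]; rewrite ?expr1 ?expr0 ?opprK//.
by rewrite e eqxx in il.
Qed.

Lemma sum_antisym (P : pred 'I_n) (F : 'I_n -> 'I_n -> R) :
  (forall i l, P i -> P l -> i != l -> F i l = - F l i) ->
  \sum_(i | P i) \sum_(l | P l && (l != i)) F i l = 0.
Proof.
move=> FN; set S := (X in X = 0).
have : S = - S.
  rewrite {1}/S (exchange_big_dep P)/=; last by move=> i l _ /andP[].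
  rewrite /S -sumrN; apply: eq_bigr => l Pl; rewrite -sumrN.
  apply: eq_big => [i|i /andP[Pi /andP[_ il]]]; first by rewrite Pl eq_sym.
  by rewrite FN// eq_sym.
by lra.
Qed.

(** Cartan's formula in coordinates.  Think of [b I L i] as the bilinear pairing
of [phi_I] with the [i]-th partial derivative of [theta_L].  The two
hypotheses say that [theta] is closed and that [phi] is coclosed, tested
against arbitrary coefficients.  Closedness at [j |: I] expresses the terms
with [j] outside of [I], coclosedness at [L :\ j] those with [j] in [L],
through the pairings of [phi_(i |: (L :\ j))] with the [i]-th derivative of
[theta_L].  Both expressions contain the same pairings, once
[I = i |: (L :\ j)], and the signs are opposite because exactly one of
[i < j] and [j < i] holds. *)
Lemma cartan_sum (b : {set 'I_n} -> {set 'I_n} -> 'I_n -> R) :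
  (forall I K, \sum_(i in K) ext_sign i K * b I (K :\ i)%SET i = 0) ->
  (forall J L, \sum_(i | i \notin J) ext_sign i J * b (i |: J)%SET L i = 0) ->
  forall j, \sum_(I : {set 'I_n}) b I I j = 0.
Proof.
move=> hA hB j.
rewrite (bigID (fun I : {set 'I_n} => j \in I))/=.
have E1 (L : {set 'I_n}) : j \in L -> b L L j =
    - \sum_(i | i \notin L) ext_sign j L * ext_sign i (L :\ j)%SET * b (i |:
        (L :\ j))%SET L i.
  move=> jL; have := hB (L :\ j)%SET L.
  rewrite (bigD1 j)/= ?finset.setD11// finset.setD1K// ext_signD1.
  move=> /(congr1 (fun t => ext_sign j L * t));
    rewrite mulrDr mulrA ext_signK mul1r mulr0.
  move=> /eqP; rewrite addr_eq0 => /eqP ->; congr (- _).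
  rewrite mulr_sumr; apply: eq_big => [i|i _]; last by rewrite mulrA.
  rewrite !inE; case: eqP => [->|_]; first by rewrite jL.
  by rewrite andbT.
have E2 (I : {set 'I_n}) : j \notin I -> b I I j =
    - \sum_(i in I) ext_sign j I * ext_sign i (j |: I)%SET * b I
        ((j |: I) :\ i)%SET i.
  move=> jI; have := hA I (j |: I)%SET.
  rewrite (bigD1 j)/= ?finset.setU11// finset.setU1K// ext_sign_self.
  move=> /(congr1 (fun t => ext_sign j I * t));
    rewrite mulrDr mulrA ext_signK mul1r mulr0.
  move=> /eqP; rewrite addr_eq0 => /eqP ->; congr (- _).
  rewrite mulr_sumr; apply: eq_big => [i|i _]; last by rewrite mulrA.
  rewrite !inE; case: eqP => [->|_]; first by rewrite (negbTE jI).
  by rewrite andbT.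
rewrite (eq_bigr _ E1) [X in _ + X](eq_bigr _ E2) !sumrN -opprD.
apply/eqP; rewrite oppr_eq0; apply/eqP.
rewrite (exchange_big_dep (fun i => i != j))/=; last first.
  by move=> L i jL; apply: contraNneq => ->.
rewrite [X in _ + X](exchange_big_dep (fun i => i != j))/=; last first.
  by move=> L i jL; apply: contraTneq => ->.
rewrite -big_split /= big1// => i ij.
(* Match [I] with [L] by exchanging [i] and [j]. *)
rewrite [X in _ + X](reindex_onto (fun L : {set 'I_n} => i |: (L :\ j))%SET
    (fun I : {set 'I_n} => j |: (I :\ i))%SET)/=; last first.
  move=> I /andP[jI iI]; apply/finset.setP => l; rewrite !inE.
  have [->|li] := eqVneq l i; first by rewrite iI.
  by have [->|lj] := eqVneq l j; rewrite ?(negbTE jI).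
rewrite -[X in X + _]opprK addrC; apply/eqP; rewrite subr_eq0 -sumrN; apply/eqP.
apply: eq_big => [L|L].
  rewrite !inE !eqxx (eq_sym j i) (negbTE ij) /=.
  apply/idP/andP => [/eqP <-|[jL iL]].
    by rewrite !inE eqxx (negbTE ij) eqxx.
  apply/eqP/finset.setP => l; rewrite !inE.
  have [->|li] := eqVneq l j; first by rewrite jL.
  by have [->|//] := eqVneq l i; rewrite (negbTE iL).
move=> /andP[_ /eqP LE].
have jL : j \in L by rewrite -LE !inE eqxx.
have iL : i \notin L by rewrite -LE !inE eqxx (negbTE ij).
have iLj : i \notin (L :\ j)%SET by rewrite !inE (negbTE iL) andbF.
have -> : ((j |: (i |: (L :\ j))) :\ i)%SET = L.
  apply/finset.setP => l; rewrite !inE; have [->|li] := eqVneq l i;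
    first by rewrite (negbTE iL).
  by have [->|] := eqVneq l j.
have -> : ext_sign i (j |: (i |: (L :\ j)))%SET = (-1) ^+
  (j < i)%N * ext_sign i (L :\ j)%SET.
  by rewrite finset.setUCA ext_sign_self ext_signU1// !inE eqxx.
rewrite ext_signU1// ext_signD1 -mulNr; congr (_ * _).
have ji : j != i by rewrite eq_sym.
have h := sign_lt_swap ji.
by rewrite h mulrACA mulNr -expr2 sqrr_sign mulN1r.
Qed.

End signs.

(** * Exact currents are closed, coexact currents are coclosed *)

Section closed.
Context {R : realType} {n : nat}.
Implicit Types (I J K L : {set 'I_n}) (i j l : 'I_n) (a x : 'rV[R]_n).
Implicit Types T u : ext_form n (schwartz R n -> R).

(** Symmetry of the second derivatives of a test function is what makes
[d d = 0] and [delta delta = 0] hold for currents tested against it. *)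
Definition partials_commute (psi : schwartz R n) := forall i l,
  schwartz_partial i (schwartz_partial l psi) = schwartz_partial l
    (schwartz_partial i psi).

Lemma current_dE T I psi : current_d T I psi =
  \sum_(i in I) ext_sign i I * - T (I :\ i)%SET (schwartz_partial i psi).
Proof.
rewrite /current_d fct_sumE fct_sumE [RHS]big_mkcond /=; apply: eq_bigr => i _.
rewrite wedge_dxl finset.sub1set; case: ifP => // iI.
by rewrite ext_sign_inversions ext_signD1.
Qed.

Lemma current_deltaE T I psi : current_delta T I psi =
  \sum_(i | i \notin I) ext_sign i I * T (i |: I)%SET (schwartz_partial i psi).
Proof.
rewrite /current_delta.
rewrite [LHS](_ : _ = - (\sum_(i < n) iota_form i (current_partial i T)) I psi)//.
rewrite fct_sumE fct_sumE -sumrN [RHS]big_mkcond /=; apply: eq_bigr => i _.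
rewrite /iota_form; case: ifP => //= iI; first by rewrite oppr0.
rewrite ext_sign_inversions.
rewrite [in LHS](_ : (_ *: _) psi = ext_sign i I * - T (i |: I)%SET
  (schwartz_partial i psi))//.
by rewrite mulrN opprK.
Qed.

(** [d d = 0]: the sum over pairs [(i, l)] is antisymmetric. *)
Lemma current_dd T u psi K : partials_commute psi -> u = current_d T ->
  \sum_(i in K) ext_sign i K * u (K :\ i)%SET (schwartz_partial i psi) = 0.
Proof.
move=> comm ->.
pose F i l := ext_sign i K * (ext_sign l (K :\ i)%SET *
   - T (K :\ i :\ l)%SET (schwartz_partial l (schwartz_partial i psi))).
rewrite (eq_bigr (fun i => \sum_(l | (l \in K) && (l != i)) F i l)); last first.
  move=> i iK; rewrite current_dE mulr_sumr; apply: eq_bigl => l.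
  by rewrite !inE andbC.
apply: sum_antisym => i l iK lK il; rewrite /F.
have -> : (K :\ l :\ i)%SET = (K :\ i :\ l)%SET.
  by apply/finset.setP => m; rewrite !inE andbCA.
rewrite comm.
have h1 : ext_sign i K = (-1) ^+ (l < i)%N * ext_sign i (K :\ l)%SET :> R.
  by rewrite -{1}(finset.setD1K lK) ext_signU1// !inE eqxx.
have h2 : ext_sign l K = (-1) ^+ (i < l)%N * ext_sign l (K :\ i)%SET :> R.
  by rewrite -{1}(finset.setD1K iK) ext_signU1// !inE eqxx.
rewrite h1 h2 (sign_lt_swap il); ring.
Qed.

Lemma current_deltadelta T u psi J : partials_commute psi -> u = current_delta
  T ->
  \sum_(i | i \notin J) ext_sign i J * u (i |: J)%SET
    (schwartz_partial i psi) = 0.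
Proof.
move=> comm ->.
pose F i l := ext_sign i J * (ext_sign l (i |: J)%SET *
   T (l |: (i |: J))%SET (schwartz_partial l (schwartz_partial i psi))).
rewrite (eq_bigr (fun i => \sum_(l | (l \notin J) && (l != i)) F i l));
  last first.
  move=> i iJ; rewrite current_deltaE mulr_sumr; apply: eq_bigl => l.
  by rewrite !inE negb_or andbC.
apply: sum_antisym => i l iJ lJ il; rewrite /F.
rewrite finset.setUCA comm (ext_signU1 _ iJ) (ext_signU1 _ lJ)
  (sign_lt_swap il); ring.
Qed.

End closed.

(** * Orthogonality to the derivatives of Gaussians *)

Section gauss_schwartz.
Context {R : realType} {n : nat}.
Variables (c : R) (c0 : 0 < c).
Implicit Types (i j l : 'I_n) (a x y : 'rV[R]_n).

Definition gauss_schwartz a : schwartz R n := Schwartz (polygauss_schwartz a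
  (fun=> 1) c0).

(** The [i]-th partial derivative of the centred Gaussian. *)
Definition gauss_partial i y : R := - (2 * c * y 0 i) * gaussian c y.

Lemma schwartz_partial_gauss i a x :
  schwartz_partial i (gauss_schwartz a) x = gauss_partial i (x - a).
Proof.
rewrite [LHS](_ : _ = partial i (polygauss c a (fun=> 1)) x)// partial_polygauss.
rewrite /gauss_partial gaussianE /polygauss
  (bigD1 i)//= [in RHS](bigD1 i)//= mulrA.
congr (_ * _).
  rewrite /subst_factor eqxx /polygauss1 /dpolygauss !mxE; congr (_ * _).
  by rewrite derivC sub0r mulr1 hornerN hornerZ hornerX.
apply: eq_bigr => l li; rewrite /subst_factor
  (negbTE li) /polygauss1 hornerC mul1r.
by rewrite !mxE.
Qed.

Lemma gauss_commute a : partials_commute (gauss_schwartz a).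
Proof.
move=> i l; apply: val_inj => /=; rewrite !partial_polygauss.
have [->//|il] := eqVneq i l.
congr polygauss; apply/funext => m;
  rewrite /subst_factor (eq_sym l i) (negbTE il).
by have [->|_] := eqVneq m i; rewrite ?(negbTE il).
Qed.

Lemma gauss_partialN i y : gauss_partial i (- y) = - gauss_partial i y.
Proof. by rewrite /gauss_partial gaussianN mxE mulrN mulNr. Qed.

Lemma measurable_gauss_partial i : measurable_fun setT (gauss_partial i).
Proof.
apply: measurable_funM; last exact: measurable_gaussian.
apply: measurable_funN; apply: measurable_funM => //.
exact: measurable_rV_coord.
Qed.

Lemma gauss_partial_le i a x : `|gauss_partial i (x - a)| <=
  2 * c * (1 + 2 / c) * expR (c / 2 * sqnorm a) * gaussian (c / 4) x.
Proof.
have c2 : 0 < c / 2 by rewrite divr_gt0.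
rewrite /gauss_partial mulNr normrN -[X in `|X|]mulrA normrM.
rewrite [X in X * _]ger0_norm ?mulr_ge0 ?(ltW c0)//.
rewrite -[leRHS]mulrA -[leRHS]mulrA ler_wpM2l ?mulr_ge0 ?(ltW c0)//.
rewrite normrM [X in _ * X]ger0_norm ?gaussian_ge0//.
apply: (le_trans (norm_coord_gaussian _ _ c0)).
rewrite ler_wpM2l//; first by rewrite addr_ge0 ?divr_ge0 ?(ltW c0).
have -> : c / 4 = c / 2 / 2 by field.
have h := gaussianD x (- a) c2; rewrite sqnormN in h; exact: h.
Qed.

End gauss_schwartz.

Section vanish.
Context {R : realType} {n : nat}.
Local Notation mu := (@lebesgue_rV R n).
Implicit Types (i j l : 'I_n) (a x y : 'rV[R]_n) (I J K L : {set 'I_n}).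

Lemma Rintegral_sum (J : finType) (F : J -> 'rV[R]_n -> R) (P : pred J) :
  (forall m : J, mu.-integrable setT (fun x => (F m x)%:E)) ->
  \int[mu]_x \sum_(m | P m) F m x = \sum_(m | P m) \int[mu]_x F m x.
Proof.
move=> iF; apply: EFin_inj; rewrite /Rintegral fineK; last first.
  apply: integrable_fin_num => //; under eq_fun do rewrite -sumEFin.
  by apply: integrable_sum.
rewrite -sumEFin; under eq_integral do rewrite -sumEFin.
rewrite integral_sum//; apply: eq_bigr => m _.
by rewrite fineK//; exact: integrable_fin_num.
Qed.

Lemma Rintegral_sum_eq0 (F : 'I_n -> 'rV[R]_n -> R) (P : pred 'I_n)
  (k : 'I_n -> R) :
  (forall i, mu.-integrable setT (fun x => (F i x)%:E)) ->
  (forall x, \sum_(i | P i) k i * F i x = 0) ->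
  \sum_(i | P i) k i * \int[mu]_x F i x = 0.
Proof.
move=> iF F0.
have ikF i : mu.-integrable setT (fun x => (k i * F i x)%:E).
  by under eq_fun do rewrite EFinM; exact: integrableZl.
rewrite (eq_bigr (fun i => \int[mu]_x (k i * F i x))); last first.
  by move=> i _; rewrite RintegralZl//; exact: iF.
rewrite -Rintegral_sum//.
by under eq_Rintegral do rewrite F0; rewrite Rintegral_cst// mul0r.
Qed.

Variables p q : R.
Hypotheses (p1 : 1 < p) (q1 : 1 < q) (pq : p^-1 + q^-1 = 1).
Variables (c : R) (c0 : 0 < c).
Variables theta phi : ext_form n ('rV[R]_n -> R).
Hypotheses (theta_Lp : forall I, theta I \in Lfun mu p%:E)
  (phi_Lq : forall I, phi I \in Lfun mu q%:E).
Hypothesis theta_closed : forall K a,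
  \sum_(i in K) ext_sign i K * distribution_of (theta (K :\ i)%SET)
    (schwartz_partial i (gauss_schwartz c0 a)) = 0.
Hypothesis phi_coclosed : forall J a,
  \sum_(i | i \notin J) ext_sign i J * distribution_of (phi (i |: J)%SET)
    (schwartz_partial i (gauss_schwartz c0 a)) = 0.

(** The distributional derivative of the correlation of [phi] and [theta]
vanishes, tested on a Gaussian.  By Fubini's theorem the coefficients that
enter [cartan_sum] are integrals of [phi_I] against [theta_L] smeared by the
derivative of a Gaussian centred at [x + a], and also integrals of [theta_L]
against [phi_I] smeared by the derivative of a Gaussian centred at [z - a]. *)
Lemma corr_gauss_partial_eq0 j a :
  \sum_(I : {set 'I_n}) \int[mu]_y (corr (phi I)
    (theta I) y * gauss_partial c j (y - a)) = 0.
Proof.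
pose g i y := gauss_partial c i (y - a).
have mg i : measurable_fun setT (g i).
  by apply: (measurableT_comp (measurable_gauss_partial c i));
    exact: measurable_translate.
have c4 : 0 < c / 4 by rewrite divr_gt0.
have gK i y := gauss_partial_le c0 i a y.
pose b I L i := \int[mu]_y (corr (phi I) (theta L) y * g i y).
apply: (cartan_sum (b := b)) => [I K|J L].
- under eq_bigr => i _ do rewrite /b
    (integral_corrM_z p1 q1 pq (phi_Lq I) (theta_Lp _) c4 (mg i) (gK i)).
  apply: Rintegral_sum_eq0 => [i|x].
    exact: (integrable_inner_z p1 q1 pq (phi_Lq I) (theta_Lp _) c4 (mg i) (gK i)).
  under eq_bigr do rewrite mulrCA.
  rewrite -mulr_sumr; apply/eqP; rewrite mulf_eq0; apply/orP; right; apply/eqP.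
  rewrite -[RHS](theta_closed K (x + a)); apply: eq_bigr => i _; congr (_ * _).
  apply: eq_Rintegral => z _; rewrite schwartz_partial_gauss.
  by rewrite /g opprD addrA.
- under eq_bigr => i _ do rewrite /b
    (integral_corrM_x p1 q1 pq (phi_Lq _) (theta_Lp L) c4 (mg i) (gK i)).
  apply: Rintegral_sum_eq0 => [i|z].
    exact: (integrable_inner_x p1 q1 pq (phi_Lq _) (theta_Lp L) c4 (mg i) (gK i)).
  under eq_bigr do rewrite mulrCA.
  rewrite -mulr_sumr; apply/eqP; rewrite mulf_eq0; apply/orP; right; apply/eqP.
  rewrite -[RHS]oppr0 -[X in - X](phi_coclosed J (z - a)) -sumrN;
    apply: eq_bigr => i _; rewrite -mulrN; congr (_ * _).
  rewrite /distribution_of -mulN1r -RintegralZl//.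
    apply: eq_Rintegral => x _; rewrite schwartz_partial_gauss.
    by rewrite mulN1r -mulrN -gauss_partialN opprB /g addrAC.
  have gp : (fun x => gauss_partial c i (x - (z - a))) \in Lfun mu p%:E.
    apply: (Lfun_gaussian_dom (lt_trans ltr01 p1) c4 _ (gauss_partial_le c0 i
      (z - a))).
    by apply: (measurableT_comp (measurable_gauss_partial c i));
      exact: measurable_translate.
  have := hoelder_integrable (lt_trans ltr01 p1) (lt_trans ltr01 q1) pq
    (phi_Lq (i |: J)%SET) gp.
  apply: eq_integrable => // x _; congr (_ * _)%:E;
    exact/esym/schwartz_partial_gauss.
Qed.

End vanish.

(** * From derivatives to Gaussians *)

Section constant.
Context {R : realType} {n : nat}.
Local Notation mu := (@lebesgue_rV R n).
Implicit Types (x y : 'rV[R]_n) (s t : R).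

Variables (f : 'rV[R]_n -> R) (M : R) (c : R) (j : 'I_n).
Hypotheses (mf : measurable_fun setT f) (fM : forall y, `|f y| <= M) (c0 : 0 < c).

Lemma sqnorm_sub_ej y t : sqnorm (y - t *: 'e_j) = sqnorm y - 2 * t * y 0 j + t
  ^+ 2.
Proof.
rewrite /sqnorm (bigD1 j)//= [in RHS](bigD1 j)//= !mxE !eqxx /= mulr1.
rewrite (eq_bigr (fun i => y 0 i ^+ 2)); first by ring.
by move=> i ij; rewrite !mxE (negbTE ij) mulr0 subr0.
Qed.

Lemma is_derive_gaussian_shift y t :
  is_derive t 1 (fun s => gaussian c (y - s *: 'e_j)) (- gauss_partial c j
    (y - t *: 'e_j)).
Proof.
have h1 : is_derive t 1 (fun s : R => sqnorm y - 2 * s * y 0 j + s ^+ 2) (2 *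
  (t - y 0 j)).
  have h := is_deriveD (is_deriveZ (- 2 * y 0 j) (is_derive_id t 1))
    (is_deriveX 2 (is_derive_id t 1)).
  have {}h := is_deriveD (is_derive_cst (sqnorm y) t 1) h.
  have E : (fun s : R => sqnorm y - 2 * s * y 0 j + s ^+ 2) =
     (cst (sqnorm y) + ((- 2 * y 0 j) \*: (id : R -> R) + (id : R -> R) ^+ 2)).
    apply/funext => s.
    rewrite [RHS](_ : _ = sqnorm y + (-2 * y 0 j * s + s ^+ 2))//; ring.
  rewrite E; apply: (is_derive_eq h); rewrite /GRing.scale /=; ring.
have h2 := is_deriveZ (- c) h1.
have h3 := is_derive1_comp (is_derive_expR _) h2.
have E : (fun s => gaussian c (y - s *: 'e_j)) =
    expR \o (- c \*: (fun s : R => sqnorm y - 2 * s * y 0 j + s ^+ 2)).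
  by apply/funext => s; rewrite /gaussian sqnorm_sub_ej.
rewrite E; apply: (is_derive_eq h3).
rewrite /gauss_partial /gaussian sqnorm_sub_ej !mxE !eqxx /GRing.scale /=.
rewrite mulr1; ring.
Qed.

Hypothesis f_orth : forall t, \int[mu]_y (f y * gauss_partial c j
  (y - t *: 'e_j)) = 0.
Hypothesis f_decay : forall y, f (y + m%:R *: 'e_j) @[m --> \oo] --> (0 : R).

Let k t y := f y * gaussian c (y - t *: 'e_j).

Lemma bounded_mul_integrable (g : 'rV[R]_n -> R) :
  mu.-integrable setT (EFin \o g) -> mu.-integrable setT (fun y =>
    (f y * g y)%:E).
Proof.
move=> ig; have mg : measurable_fun setT g by apply/measurable_EFinP;
  case/integrableP: ig.
apply: (@le_integrable _ _ _ mu _ measurableT _ (fun y => M%:E *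
  (EFin \o g) y)%E).
- by apply/measurable_EFinP; exact: measurable_funM.
- move=> y _ /=; rewrite lee_fin normrM [leRHS]normrM ler_wpM2r//.
  by rewrite (le_trans (fM y))// ler_norm.
- exact: integrableZl.
Qed.

Lemma integrable_gaussian_shift s (x : 'rV[R]_n) : 0 < s ->
  mu.-integrable setT (EFin \o (fun y => gaussian s (y - x))).
Proof.
move=> s0; apply/Lfun1_integrable.
apply: (Lfun_translate (- x)); apply: (@Lfun_gaussian_dom _ _ _ 1 s) => //.
  exact: measurable_gaussian.
by move=> y; rewrite mul1r ger0_norm ?gaussian_ge0.
Qed.

Let dk y t : is_derive t 1 (k ^~ y) (- (f y * gauss_partial c j (y - t *: 'e_j))).
Proof.
have h := is_deriveZ (f y) (is_derive_gaussian_shift y t).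
by apply: (is_derive_eq h); rewrite /GRing.scale /= mulrN.
Qed.

Lemma sqnorm_ej t : sqnorm (t *: 'e_j : 'rV[R]_n) = t ^+ 2.
Proof.
have := sqnorm_sub_ej 0 t; rewrite add0r sqnormN => ->.
have -> : sqnorm (0 : 'rV[R]_n) = 0 by rewrite /sqnorm big1// => i _;
  rewrite mxE expr0n.
by rewrite mxE; ring.
Qed.

(** Differentiation under the integral sign: as long as the shift stays within
distance [1] of [t], a single Gaussian dominates all the derivatives. *)
Lemma derive_integral_gaussian t :
  is_derive t 1 (fun s => \int[mu]_y k s y) 0.
Proof.
(* The constant of [gauss_partial_le] at the largest admissible shift. *)
pose Kt := 2 * c * (1 + 2 / c) * expR (c / 2 * (`|t| + 1) ^+ 2).
have c4 : 0 < c / 4 by rewrite divr_gt0.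
have M0 : 0 <= M by apply: (le_trans (normr_ge0 (f 0))).
have Kt0 : 0 <= Kt.
  by rewrite /Kt !mulr_ge0 ?expR_ge0 ?addr_ge0 ?divr_ge0 ?(ltW c0).
pose G y := M * (Kt * gaussian (c / 4) y).
have Ia : `]t - 1, t + 1[%classic t by rewrite /= in_itv/= ltrBlDr ltrDl ltr01.
have intk s : `]t - 1, t + 1[%classic s -> mu.-integrable setT (EFin \o k s).
  by move=> _; apply: bounded_mul_integrable; exact: integrable_gaussian_shift.
have der s y : `]t - 1, t + 1[%classic s -> setT y -> derivable (k ^~ y) s 1.
  by move=> _ _; have [] := dk y s.
have G0 y : 0 <= G y.
  by apply: mulr_ge0 => //; apply: mulr_ge0 => //; exact: gaussian_ge0.
have iG : mu.-integrable setT (EFin \o G).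
  have := integrable_gaussian_shift 0 c4; under eq_fun do rewrite subr0.
  move=> h; rewrite [X in _.-integrable _ X](_ : _ = fun y => ((M * Kt)%:E *
    (EFin \o gaussian (c / 4)) y)%E).
    exact: integrableZl.
  by apply/funext => y /=; rewrite /G mulrA.
have Gub s y : `]t - 1, t + 1[%classic s -> setT y -> `|partial1of2 k s y| <= G y.
  rewrite /= in_itv/= => /andP[s1 s2] _.
  rewrite partial1of2E; have [_ ->] := dk y s.
  rewrite normrN normrM /G ler_pM//.
  rewrite (le_trans (gauss_partial_le c0 j _ y))// ler_wpM2r ?gaussian_ge0//.
  rewrite /Kt ler_wpM2l ?mulr_ge0 ?addr_ge0 ?divr_ge0 ?(ltW c0)//.
  rewrite ler_expR ler_wpM2l ?divr_ge0 ?(ltW c0)// sqnorm_ej.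
  rewrite -real_normK ?num_real// lerXn2r ?nnegrE ?addr_ge0//.
  rewrite ler_norml; apply/andP; split.
    by have := ler_norm (- t); rewrite normrN; lra.
  by have := ler_norm t; lra.
have d := derivable_under_integral measurableT Ia intk der G0 iG Gub.
have e := differentiation_under_integral measurableT Ia intk der G0 iG Gub.
apply: DeriveDef; first exact: d.
rewrite -derive1E e.
have E : (fun y => partial1of2 k t y) = (fun y => -1 *
  (f y * gauss_partial c j (y - t *: 'e_j))).
  by apply/funext => y; rewrite partial1of2E mulN1r; have [_ ->] := dk y t.
transitivity (\int[mu]_y (-1 * (f y * gauss_partial c j (y - t *: 'e_j)))).
  by apply: eq_Rintegral => y _;
    rewrite -[LHS]/((fun y => partial1of2 k t y) y) E.
rewrite RintegralZl//; first by rewrite f_orth mulr0.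
apply: bounded_mul_integrable; apply/Lfun1_integrable.
apply: (Lfun_gaussian_dom ltr01 c4 _ (gauss_partial_le c0 j _)).
by apply: (measurableT_comp (measurable_gauss_partial c j));
  exact: measurable_translate.
Qed.

(** The integral of [f] against the Gaussian centred at [t e_j] is constant in
[t]; for [t = m] it is the integral of the translate of [f] against the centred
Gaussian, which tends to [0]. *)
Lemma integral_gaussian_eq0 : \int[mu]_y (f y * gaussian c y) = 0.
Proof.
have F0 t : \int[mu]_y k t y = \int[mu]_y k 0 y.
  apply: (@is_derive_0_is_cst _ (fun s => \int[mu]_y k s y) t 0).
  exact: derive_integral_gaussian.
have -> : \int[mu]_y (f y * gaussian c y) = \int[mu]_y k 0 y.
  by apply: eq_Rintegral => y _; rewrite /k scale0r subr0.
have FE m : \int[mu]_y k m%:R y = \int[mu]_y (f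
  (y + m%:R *: 'e_j) * gaussian c y).
  rewrite /Rintegral -(integral_translate (m%:R *: 'e_j)).
    by congr fine; apply: eq_integral => y _; rewrite /k addrK.
  apply/measurable_EFinP; apply: measurable_funM => //.
  by apply: (measurableT_comp (measurable_gaussian c));
    exact: measurable_translate.
have ig : mu.-integrable setT (EFin \o gaussian c).
  by have := integrable_gaussian_shift 0 c0; under eq_fun do rewrite subr0.
have L : \int[mu]_y (f (y + m%:R *: 'e_j) * gaussian c y) @[m --> \oo] -->
  (0 : R).
  rewrite /Rintegral; apply: fine_cvg.
  rewrite (_ : 0%:E = \int[mu]_(x in setT) 0%E)%E; last by rewrite integral0.
  apply: (@dominated_cvg _ _ _ mu _ measurableT _ _ (fun y => M%:E *
    (EFin \o gaussian c) y)%E) => //.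
  - move=> m; apply/measurable_EFinP; apply: measurable_funM;
      last exact: measurable_gaussian.
    by apply: (measurableT_comp mf); exact: measurable_translate.
  - move=> y _; apply: cvg_EFin; first exact: nearW.
    by rewrite -(mul0r (gaussian c y)); apply: cvgM => //; exact: cvg_cst.
  - exact: integrableZl.
  - by move=> m y _ /=; rewrite lee_fin normrM [X in _ * X]ger0_norm
      ?gaussian_ge0// ler_wpM2r ?gaussian_ge0.
apply: (cvg_unique _ _ L) => //.
apply: cvg_near_cst; apply: nearW => m; by rewrite -FE F0.
Qed.

End constant.

(** * Concentration at the origin *)

Section scaling.
Context {R : realType} {n : nat}.
Local Open Scope ereal_scope.
Local Notation mu := (@lebesgue_rV R n).

(** Scaling multiplies the integrals of the positive and negative parts by the
same positive factor. *)
Lemma integral_rV_scale0 (s : R) (g : 'rV[R]_n -> \bar R) : (0 < s)%R ->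
  mu.-integrable setT g -> \int[mu]_x g x = 0 -> \int[mu]_x g (s *: x)%R = 0.
Proof.
move=> s0 ig; have mg := measurable_int _ ig.
have E h : measurable_fun setT h -> (forall x, 0 <= h x) ->
    \int[mu]_x h (s *: x)%R = ((s ^+ n)^-1)%:E * \int[mu]_x h x.
  move=> mh h0; rewrite (ge0_integral_rV_affine 0%R s0 mh h0).
  rewrite muleA -EFinM mulVf ?mul1e; last by rewrite gt_eqF// exprn_gt0.
  by apply: eq_integral => x _; rewrite addr0.
have fn : \int[mu]_x g^\- x \is a fin_num.
  by apply: integrable_fin_num => //; exact: integrable_funeneg.
rewrite integralE => /eqP; rewrite sube_eq//; last first.
  by apply: integrable_fin_num => //; exact: integrable_funepos.
rewrite add0e => /eqP g0; rewrite integralE.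
under eq_integral do rewrite (funepos_comp g (fun x => s *: x)%R)/=.
under [X in _ - X = _]eq_integral do rewrite (funeneg_comp g
  (fun x => s *: x)%R)/=.
rewrite (E _ (measurable_funepos mg))// (E _ (measurable_funeneg mg))// g0.
by rewrite subee// fin_numM.
Qed.

End scaling.

Section final.
Context {R : realType} {n : nat}.
Local Notation mu := (@lebesgue_rV R n).
Implicit Types (x y : 'rV[R]_n) (I : {set 'I_n}).

Variables p q : R.
Hypotheses (p1 : 1 < p) (q1 : 1 < q) (pq : p^-1 + q^-1 = 1).

Lemma measurable_corr u v : u \in Lfun mu q%:E -> v \in Lfun mu p%:E ->
  measurable_fun setT (corr u v).
Proof.
move=> uq vp.
have g1 x : `|gaussian 1 x| <= 1 * gaussian 1 x.
  by rewrite mul1r ger0_norm// gaussian_ge0.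
have /integrableP[/measurable_EFinP mc _] :=
  integrable_corrM p1 q1 pq uq vp ltr01 (@measurable_gaussian R n 1) g1.
rewrite (_ : corr u v = fun y => corr u v y * gaussian 1 y * gaussian (-1) y).
  by apply: measurable_funM => //; exact: measurable_gaussian.
apply/funext => y; rewrite -mulrA /gaussian -expRD opprK mulN1r mul1r addNr expR0.
by rewrite mulr1.
Qed.

(** The rescaled function [f(x / m)] is orthogonal to the fixed Gaussian
[exp(- |x|^2)] for every positive [m], and tends to [f(0)] as [m] grows. *)
Lemma sum_corr_eq0 (theta phi : ext_form n ('rV[R]_n -> R)) : (0 < n)%N ->
  (forall I, theta I \in Lfun mu p%:E) -> (forall I, phi I \in Lfun mu q%:E) ->
  (forall (c : R) (c0 : 0 < c) (K : {set 'I_n}) a, \sum_(i in K) ext_sign i K *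
    distribution_of (theta (K :\ i)%SET) (schwartz_partial i
      (gauss_schwartz c0 a)) = 0) ->
  (forall (c : R) (c0 : 0 < c) (J : {set 'I_n}) a, \sum_(i | i \notin J)
    ext_sign i J *
    distribution_of (phi (i |: J)%SET) (schwartz_partial i
      (gauss_schwartz c0 a)) = 0) ->
  \sum_I corr (phi I) (theta I) 0 = 0.
Proof.
move=> n0 tp pq' tc pc.
pose j : 'I_n := Ordinal n0.
pose f y := \sum_I corr (phi I) (theta I) y.
pose M := \sum_I Lnormr mu q (phi I) * Lnormr mu p (theta I).
have mf : measurable_fun setT f by apply: measurable_sum => I;
  exact: measurable_corr.
have fM y : `|f y| <= M.
  rewrite (le_trans (ler_norm_sum _ _ _))// ler_sum// => I _.
  exact: (corr_le p1 q1 pq).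
have f_decay y : f (y + m%:R *: 'e_j) @[m --> \oo] --> (0 : R).
  rewrite [X in _ --> X](_ : _ = \sum_(I : {set 'I_n}) (0 : R));
    last by rewrite big1.
  apply: cvg_big => [|I _]; first exact: add_continuous.
  exact: (corr_cvg0 p1 q1 pq).
have fG c : 0 < c -> \int[mu]_y (f y * gaussian c y) = 0.
  move=> c0; apply: (integral_gaussian_eq0 (M := M) (j := j)) => // t.
  rewrite -[RHS](corr_gauss_partial_eq0 p1 q1 pq tp pq' (tc c c0) (pc c c0) j
    (t *: 'e_j)).
  under eq_Rintegral do rewrite mulr_suml.
  apply: Rintegral_sum => I.
  have c4 : 0 < c / 4 by rewrite divr_gt0.
  apply: (integrable_corrM p1 q1 pq (pq' I) (tp I) c4 _
    (gauss_partial_le c0 j _)).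
  by apply: (measurableT_comp (measurable_gauss_partial c j));
    exact: measurable_translate.
have ig c : 0 < c -> mu.-integrable setT (EFin \o gaussian c).
  move=> c0; have := @integrable_gaussian_shift R n c 0 c0.
  by apply: eq_integrable => // y _; rewrite /= subr0.
(* Rescaling the Gaussian of parameter [s ^- 2] by [s] gives [gaussian 1]. *)
have h0 m : (\int[mu]_x (f (m.+1%:R^-1 *: x) * gaussian 1 x)%:E = 0)%E.
  pose s : R := m.+1%:R^-1.
  have s0 : 0 < s by rewrite invr_gt0.
  have c0 : 0 < s ^- 2 by rewrite invr_gt0 exprn_gt0.
  have ifg := bounded_mul_integrable mf fM (ig _ c0).
  have := integral_rV_scale0 s0 ifg.
  rewrite -(fineK (integrable_fin_num measurableT ifg)) -/(Rintegral _ _ _)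
    fG// => /(_ erefl) <-.
  apply: eq_integral => x _; congr (_ * _)%:E.
  by rewrite gaussian_scale.
have [r r0 rE] := @integral_gaussian R n 1 ltr01.
have L : (\int[mu]_x (f (m.+1%:R^-1 *: x) * gaussian 1 x)%:E @[m --> \oo] -->
    \int[mu]_x (f 0 * gaussian 1 x)%:E)%E.
  apply: (@dominated_cvg _ _ _ mu _ measurableT _ _ (fun y => M%:E *
    (EFin \o gaussian 1) y)%E) => //.
  - move=> m; apply/measurable_EFinP; apply: measurable_funM;
      last exact: measurable_gaussian.
    have := @measurable_rV_affine R n (m.+1%:R^-1) 0.
    under eq_fun do rewrite addr0.
    exact: measurableT_comp.
  - move=> x _; apply: cvg_EFin; first exact: nearW.
    apply: cvgM; last exact: cvg_cst.
    apply: cvg_big => [|I _]; first exact: add_continuous.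
    apply: (cvg_corr p1 q1 pq (C := sqnorm x) (pq' I) _ _ (tp I)).
    + move=> i; under eq_fun do rewrite mxE.
      by rewrite -(mul0r (x 0 i)); apply: cvgM;
        [exact: cvg_harmonic|exact: cvg_cst].
    + move=> m; rewrite sqnormZ ler_piMl ?sqnorm_ge0// exprn_ile1// ?invr_ge0//.
      by rewrite invf_le1// ler1n.
  - by apply: integrableZl => //; exact: ig.
  - by move=> m y _ /=; rewrite lee_fin normrM [X in _ * X]ger0_norm
      ?gaussian_ge0// ler_wpM2r ?gaussian_ge0.
have : (\int[mu]_x (f 0 * gaussian 1 x)%:E = 0)%E.
  apply: (cvg_unique _ L) => //.
  by apply: cvg_near_cst; apply: nearW => m; exact: h0.
under eq_integral do rewrite EFinM.
rewrite integralZl//; last exact: ig.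
by rewrite rE -EFinM => -[/eqP]; rewrite mulf_eq0 (gt_eqF r0) orbF => /eqP.
Qed.

Lemma wedge_hodge_setT (u v : ext_form n R) :
  wedge (V := R^o) u (hodge v) [set: 'I_n]%SET = \sum_I u I * v I.
Proof.
rewrite /wedge; apply: eq_big => [I|I _]; first exact: finset.subsetT.
rewrite /hodge finset.setTD finset.setCK /GRing.scale /=.
by rewrite mulrCA [X in _ * X]mulrA -expr2 sqrr_sign mul1r.
Qed.

End final.

Theorem corollary1p3 (R : realType) (n k : nat) (p q : R)
    (p_gt1 : 1 < p) (q_gt1 : 1 < q) (pq : p^-1 + q^-1 = 1)
    (n_ge1 : (1 <= n)%N) (k_le_n : (k <= n)%N)
    (theta phi : ext_form n ('rV[R]_n -> R)) :
  EL p k%:Z theta -> EstarL q k%:Z phi -> pairing theta phi = 0%E.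
Proof.
move=> [[_ tp] [S _ dS]] [[_ pq'] [T _ dT]].
have f0 : \sum_(I : {set 'I_n}) corr (phi I) (theta I) 0 = 0.
  apply: (sum_corr_eq0 p_gt1 q_gt1 pq n_ge1 tp pq').
  - move=> c c0 K a; exact: (current_dd K (gauss_commute c0 a) dS).
  - move=> c c0 J a; exact: (current_deltadelta J (gauss_commute c0 a) dT).
rewrite /pairing; under eq_integral do rewrite wedge_hodge_setT -sumEFin.
have iI I : (lebesgue_rV n).-integrable setT (fun x => (phi I x * theta I x)%:E).
  exact: (hoelder_integrable (lt_trans ltr01 p_gt1) (lt_trans ltr01 q_gt1) pq).
rewrite integral_sum//; last first.
  by move=> I; have := iI I; apply: eq_integrable => // x _; rewrite mulrC.
rewrite -[RHS]/(0%:E) -f0 -sumEFin; apply: eq_bigr => I _.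
rewrite /corr fineK; last first.
  by have := integrable_fin_num measurableT (iI I);
    under eq_integral do rewrite -[x in theta _ x]addr0.
by apply: eq_integral => x _; rewrite addr0 mulrC.
Qed.
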